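(* Let $X=\{X(t)\}_{t\in\mathbb{R}^m}$ be an operator self-similar random field with values in $\mathbb{R}^n$ and with domain exponent $E\in M(m,\mathbb{R})$. Then for any range exponent $H$, i.e. for any $H\in\mathcal{E}^{\mathrm{ran}}_E(X)$, we have $$\mathcal{E}^{\mathrm{ran}}_E(X)=H+T(G_1^{\mathrm{ran}}).$$ Moreover, there exists $H_0\in\mathcal{E}^{\mathrm{ran}}_E(X)$ such that $H_0A=AH_0$ for every $A\in G_1^{\mathrm{ran}}$. The nilpotent part of every $H\in\mathcal{E}^{\mathrm{ran}}_E(X)$ is the same, and it commutes with every element of $G_1^{\mathrm{ran}}$. Furthermore, every matrix $H\in\mathcal{E}^{\mathrm{ran}}_E(X)$ has the same real spectrum (real parts of the eigenvalues).
   Context: $M(p,\mathbb{R})$ is the space of real $p\times p$ matrices; for $c>0$ and a square matrix $M$, $c^M=\exp(M\log c)$. The symbol $\simeq$ denotes equality of all finite-dimensional distributions of random fields indexed by $t\in\mathbb{R}^m$. A random vector is full if its distribution is not supported on a lower dimensional (affine) hyperplane. A random field $X=\{X(t)\}_{t\in\mathbb{R}^m}$ with values in $\mathbb{R}^n$ is proper if $X(t)$ is full for all $t\neq 0$; it is degenerate if there is a projection $P\ne I$ on $\mathbb{R}^m$ ($P^2=P$ linear) with $X(t)=X(Pt)$ for all $t$, and nondegenerate otherwise; it is stochastically continuous if $X(t_k)\to X(t)$ in probability whenever $t_k\to t$. A proper, nondegenerate, stochastically continuous field $X$ is operator self-similar (o.s.s., or $(E,H)$-o.s.s.) if for some $E\in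 M(m,\mathbb{R})$, $H\in M(n,\mathbb{R})$, $$\{X(c^Et)\}_{t\in\mathbb{R}^m}\simeq\{c^HX(t)\}_{t\in\mathbb{R}^m}\quad\text{for all }c>0.\qquad( * )$$ Standing assumption: all eigenvalues of $E$ and $H$ have strictly positive real parts (which implies $X(0)=0$ a.s.). $E$ is called a domain exponent and $H$ a range exponent. Given a domain exponent $E$, $\mathcal{E}^{\mathrm{ran}}_E(X)$ is the set of all $H\in M(n,\mathbb{R})$ such that $( * )$ holds. The range symmetries are $G_1^{\mathrm{ran}}=\{B\in M(n,\mathbb{R}): BX(t)\simeq X(t)\}$ (a compact subgroup of $GL(n,\mathbb{R})$). For a closed group $\mathcal{G}\subseteq GL(k,\mathbb{R})$, its tangent space is $$T(\mathcal{G})=\Big\{A\in M(k,\mathbb{R}): A=\lim_{j\to\infty}\frac{G_j-I}{d_j}\text{ for some }\{G_j\}\subseteq\mathcal{G}\text{ and some real }0\neq d_j\to0\Big\}.$$ The nilpotent part of a matrix $H$ is the matrix $N$ in its additive Jordan decomposition $H=S+N$, with $S$ semisimple (diagonalizable over $\mathbb{C}$), $N$ nilpotent and $SN=NS$. *)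

(* Defs.v *)
From HB Require Import structures.
From mathcomp Require Import all_boot all_order all_algebra.
From mathcomp Require Import complex.
From mathcomp Require Import all_classical all_reals all_analysis.

Set Implicit Arguments.
Unset Strict Implicit.
Unset Printing Implicit Defensive.

Import Order.TTheory GRing.Theory Num.Theory.
Import numFieldNormedType.Exports.

Local Open Scope classical_set_scope.
Local Open Scope ring_scope.

Section Matrices.
Context {R : realType} {k : nat}.
Implicit Types (M S N H : 'M[R]_k).

Definition mxexp M : 'M[R]_k :=
  limn (series (fun i => i`!%:R^-1 *: M ^+ i)).

(* [c ^ M] for [0 < c]. *)
Definition mxpow (c : R) M : 'M[R]_k := mxexp (ln c *: M).

Definition complex_mx M : 'M[R[i]]_k := map_mx (real_complex R) M.

Definition real_spectrum M : set R :=
  [set complex.Re z | z in [set z : R[i] | eigenvalue (complex_mx M) z]].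

Definition positive_real_spectrum M : Prop :=
  forall a : R, real_spectrum M a -> 0 < a.

Definition is_nilpotent_part H N : Prop :=
  exists S, [/\ H = S + N, diagonalizable (complex_mx S),
                (exists i : nat, N ^+ i = 0) & S *m N = N *m S].

Definition tangent_space (G : set 'M[R]_k) : set 'M[R]_k :=
  [set A | exists (g : nat -> 'M[R]_k) (d : nat -> R),
     [/\ forall j, G (g j), forall j, d j != 0, d @ \oo --> 0
       & (fun j => (d j)^-1 *: (g j - 1%:M)) @ \oo --> A]].

End Matrices.

Definition borel_mx (R : realType) (n k : nat) :=
  g_sigma_algebraType (@open 'M[R]_(n, k)).

Section RandomFields.
Context {d : measure_display} {T : measurableType d} {R : realType}.
Variables (P : probability T R) (m n : nat).
Implicit Types (X Y Z : 'cV[R]_m -> T -> 'cV[R]_n).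

Definition random_field X : Prop :=
  forall t, measurable_fun [set: T] (X t : T -> borel_mx R n 1).

(* The vector (Y(t_1), ..., Y(t_k)), encoded as the matrix of its columns. *)
Definition joint Y (k : nat) (t : 'I_k -> 'cV[R]_m) (w : T) : borel_mx R n k :=
  \matrix_(i < n, j < k) Y (t j) w i 0.

Definition fdd_eq Y Z : Prop :=
  forall (k : nat) (t : 'I_k -> 'cV[R]_m) (B : set (borel_mx R n k)),
    measurable B -> P (joint Y t @^-1` B) = P (joint Z t @^-1` B).

Definition full (V : T -> 'cV[R]_n) : Prop :=
  forall (a : 'rV[R]_n) (b : R), a != 0 ->
    P [set w | a *m V w = b%:M] <> 1%E.

Definition proper X : Prop := forall t, t != 0 -> full (X t).

Definition degenerate X : Prop :=
  exists Q : 'M[R]_m, [/\ Q *m Q = Q, Q != 1%:M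
    & forall t, {ae P, forall w, X t w = X (Q *m t) w}].

Definition stochastically_continuous X : Prop :=
  forall (u : nat -> 'cV[R]_m) (t : 'cV[R]_m), u @ \oo --> t ->
    forall e : R, 0 < e ->
      (fun i => P [set w | e <= `|X (u i) w - X t w|]) @ \oo --> 0%E.

Definition scaling X (E : 'M[R]_m) (H : 'M[R]_n) : Prop :=
  forall c : R, 0 < c ->
    fdd_eq (fun t => X (mxpow c E *m t)) (fun t w => mxpow c H *m X t w).

Definition operator_self_similar X (E : 'M[R]_m) (H : 'M[R]_n) : Prop :=
  [/\ random_field X, proper X, ~ degenerate X & stochastically_continuous X] /\
  [/\ positive_real_spectrum E, positive_real_spectrum H & scaling X E H].

Definition domain_exponent X (E : 'M[R]_m) : Prop :=
  exists H : 'M[R]_n, operator_self_similar X E H.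

(* No condition on the spectrum of [H]: positivity of the real parts is
   required of one range exponent only, in [domain_exponent]. *)
Definition range_exponents X (E : 'M[R]_m) : set 'M[R]_n :=
  [set H | scaling X E H].

Definition range_symmetries X : set 'M[R]_n :=
  [set B | fdd_eq (fun t w => B *m X t w) X].

End RandomFields.

(* Main.v *)
Require Import Defs.
From HB Require Import structures.
From mathcomp Require Import all_boot all_order all_algebra.
From mathcomp Require Import complex.
From mathcomp Require Import all_classical all_reals all_analysis.
From mathcomp Require Import spectral separable measurable_realfun ring lra zify.
Import Order.TTheory GRing.Theory Num.Theory.
Import numFieldNormedType.Exports.
Local Open Scope classical_set_scope.
Local Open Scope ring_scope.

Set Implicit Arguments.
Unset Strict Implicit.
Unset Printing Implicit Defensive.

(** Call [(C, A)] a similarity of [X] when [X (C t)] and [A (X t)] have the same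
    finite-dimensional laws. Similarities multiply and invert, and by stochastic
    continuity they form a closed set ([similarity_closed]). The range
    symmetries [G] are the similarities [(1, A)], and [H] is a range exponent
    when [(exp (s E), exp (s H))] is a similarity for every real [s]. Fullness
    makes every [A] invertible ([similarity_unit]) and [G] bounded
    ([range_symmetries_bounded]): if [B_j] in [G] had norms tending to infinity,
    a limit point of [B_j / |B_j|] would be a nonzero matrix killing [X t]
    almost surely.

    The set of exponents is [H + T(G)] by Lie's product argument. For two
    exponents, [exp (- s H) exp (s H')] lies in [G] and has derivative [H' - H]
    at [s = 0]. Conversely, if [(g_j - 1) / d_j] tends to [A], the powers of
    [exp (d_j H) g_j] with about [s / d_j] factors tend to [exp (s (H + A))], by
    a version of Euler's limit [(1 + d_j M_j)^k_j --> exp (s M)]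
    ([cvg_mx_euler]).

    The other claims rest on two fixed points of the bounded group [G], both
    obtained without Haar measure from [common_fixed_point]: the supremum of the
    Euclidean norm over an orbit is strictly convex and invariant, so its unique
    minimiser on an invariant closed convex set is fixed. Conjugation on the
    affine set of exponents gives an exponent [H0] commuting with [G]; the
    action [Q |-> B Q B^T] on forms bounded below gives a [G]-invariant positive
    definite form [Q].

    Differentiating [g_j Q g_j^T = Q], each [A] in [T(G)] is skew for [Q], hence
    diagonalizable over the complex numbers with imaginary spectrum, and it
    commutes with [H0]. Every exponent is thus [H0 + A] with such an [A]. Adding
    [A] to the semisimple part of [H0] keeps it semisimple, so the nilpotent
    part stays that of [H0], which is a polynomial in [H0] and so commutes with
    [G]; and a common eigenvector of [H0 + A] and [A] shows that the real parts
    of the eigenvalues do not move. *)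

(** * Matrix sequences and the maximum norm *)

Section MatrixTopology.
Context {R : realType}.

Lemma cvg_mxP (I : Type) (F : set_system I) (FF : Filter F) (p q : nat)
    (u : I -> 'M[R]_(p, q)) (M : 'M[R]_(p, q)) :
  u @ F --> M <-> forall i j, (fun l => u l i j) @ F --> M i j.
Proof.
split=> [uM i j|uM].
  exact: (@cvg_comp _ _ _ u (fun N : 'M[R]_(p, q) => N i j) _ _ _ uM (@coord_continuous R p q i j M)).
move=> A [Q QM sub]; rewrite /= nbhs_simpl /=.
have : \forall l \near F, forall i j, Q i j (u l i j).
  apply: filter_forall => i; apply: filter_forall => j.
  exact: uM (QM i j).
by apply: filterS => l Ql; apply: sub.
Qed.

Lemma cvg_mulmx (I : Type) (F : set_system I) (FF : Filter F) (p q r : nat)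
    (u : I -> 'M[R]_(p, q)) (v : I -> 'M[R]_(q, r)) (M : 'M[R]_(p, q)) (N : 'M[R]_(q, r)) :
  u @ F --> M -> v @ F --> N -> (fun l => u l *m v l) @ F --> M *m N.
Proof.
move=> /cvg_mxP uM /cvg_mxP vN; apply/cvg_mxP => i j.
under eq_fun do rewrite mxE.
rewrite mxE; apply: cvg_big => /= [|k _]; first exact: add_continuous.
exact: cvgM (uM i k) (vN k j).
Qed.

Lemma cvg_mx_unique (p q : nat) (u : nat -> 'M[R]_(p, q)) (M N : 'M[R]_(p, q)) :
  u @ \oo --> M -> u @ \oo --> N -> M = N.
Proof. by move=> uM uN; apply: (cvg_unique (@norm_hausdorff R 'M[R]_(p, q)) uM uN). Qed.

Lemma cvg_trmx (I : Type) (F : set_system I) (FF : Filter F) (p q : nat)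
    (u : I -> 'M[R]_(p, q)) (M : 'M[R]_(p, q)) : u @ F --> M -> (fun l => (u l)^T) @ F --> M^T.
Proof.
move=> /cvg_mxP uM; apply/cvg_mxP => i j.
under eq_fun do rewrite mxE.
by rewrite mxE; exact: uM j i.
Qed.

Lemma ler_entry_norm (p q : nat) (M : 'M[R]_(p, q)) i j : `|M i j| <= `|M|.
Proof.
rewrite [leRHS]/Num.norm /= mx_normrE.
exact: (le_bigmax _ (fun ij : 'I_p * 'I_q => `|M ij.1 ij.2|) (i, j)).
Qed.

Lemma mx_norm_le (p q : nat) (M : 'M[R]_(p, q)) (e : R) : 0 <= e ->
  (forall i j, `|M i j| <= e) -> `|M| <= e.
Proof.
move=> e0 Me; rewrite [leLHS]/Num.norm /= mx_normrE.
by apply/bigmax_leP; split=> // ij _; exact: Me.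
Qed.

Lemma mx_norm_lt (p q : nat) (M : 'M[R]_(p, q)) (e : R) : 0 < e ->
  (forall i j, `|M i j| < e) -> `|M| < e.
Proof.
move=> e0 Me; rewrite [ltLHS]/Num.norm /= mx_normrE.
by apply/bigmax_ltP; split=> // ij _; exact: Me.
Qed.

Lemma norm_mulmx (p q r : nat) (M : 'M[R]_(p, q)) (N : 'M[R]_(q, r)) :
  `|M *m N| <= q%:R * `|M| * `|N|.
Proof.
apply: mx_norm_le => [|i j]; first by rewrite !mulr_ge0.
rewrite mxE (le_trans (ler_norm_sum _ _ _)) //.
have -> : q%:R * `|M| * `|N| = \sum_(k < q) (`|M| * `|N|).
  by rewrite sumr_const card_ord -mulrA mulr_natl.
apply: ler_sum => k _; rewrite normrM.
by apply: ler_pM; rewrite ?ler_entry_norm.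
Qed.

Lemma cvg_dist_bound (V : normedModType R) (u : nat -> V) (l : V)
    (e : nat -> R) :
  (forall j, `|u j - l| <= e j) -> e @ \oo --> 0 -> u @ \oo --> l.
Proof.
move=> ue e0; apply/cvgrPdist_le => eps eps0.
have /cvgr0Pnorm_le /(_ _ eps0) := e0.
apply: filterS => j ej; rewrite distrC (le_trans (ue j))//.
by rewrite (le_trans (ler_norm _)).
Qed.

Lemma scalar_mx_norm_le1 n : `|1%:M : 'M[R]_n| <= 1.
Proof.
apply: mx_norm_le => // i j; rewrite mxE.
by case: (_ == _); rewrite ?normr1 ?normr0.
Qed.

Lemma limn_norm_le (V : normedModType R) (u : nat -> V) (l : V) (b : R) :
  u @ \oo --> l -> (forall j, `|u j| <= b) -> `|l| <= b.
Proof.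
move=> ul ub.
have nul : (fun j => `|u j| : R) @ \oo --> (`|l| : R) by exact: cvg_norm.
by apply: (closed_cvg (fun x : R => x <= b) (@closed_le R b) _ _ nul); exact: nearW.
Qed.

(** The index map satisfies [j <= f j] but need not be increasing: this is enough
    to pass to the limit, and it spares the extraction of a monotone one. *)
Lemma bounded_mx_subseq (p q : nat) (u : nat -> 'M[R]_(p, q)) (b : R) :
  (forall j, `|u j| <= b) ->
  exists (f : nat -> nat) (M : 'M[R]_(p, q)), (forall j, (j <= f j)%N) /\ (u \o f) @ \oo --> M.
Proof.
move=> ub.
pose K := [set v : 'rV[R]_(p * q) | forall i, `[- b, b]%classic (v ord0 i)].
have Kco : compact K.
  apply: (@rV_compact _ _ (fun=> `[- b, b]%classic : set R)) => i.
  exact: segment_compact.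
pose F := (fun j => mxvec (u j)) @ \oo.
have FK : F K.
  exists 0%N => // j _ i /=; rewrite in_itv /= -ler_norml.
  case/mxvec_indexP: i => i j'; rewrite mxvecE.
  by rewrite (le_trans (ler_entry_norm _ _ _)).
have [v [_ vF]] := Kco F _ FK.
have nearv j : exists i, (j <= i)%N /\ `|v - mxvec (u i)| < j.+1%:R^-1.
  have /(_ (fun w => exists i, (j <= i)%N /\ w = mxvec (u i))
    (ball v j.+1%:R^-1)) [] := vF.
  - by exists j => // i /= ji; exists i.
  - exact: nbhsx_ballx.
  by move=> w [[i [ji ->]] /=]; rewrite -ball_normE /= => di; exists i.
have [f fP] := choice nearv.
exists f, (vec_mx v); split=> [j|]; first by have [] := fP j.
apply: (@cvg_dist_bound _ _ _ (fun j => j.+1%:R^-1)); last exact: cvg_harmonic.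
move=> j /=; have [_ /ltW d] := fP j.
apply: mx_norm_le => // i k; apply: le_trans d.
have := ler_entry_norm (v - mxvec (u (f j))) ord0 (mxvec_index i k).
by rewrite !mxE /= mxvecE distrC.
Qed.

End MatrixTopology.

(** * The matrix exponential *)

Section MatrixExponential.
Context {R : realType} {n : nat}.
Notation mx := 'M[R]_n.+1.
Implicit Types (M N : mx) (s t u : R).

(** The maximum norm rescaled to be submultiplicative. *)
Definition mxbnd M : R := n.+1%:R * `|M|.

Lemma mxbnd_ge0 M : 0 <= mxbnd M.
Proof. exact: mulr_ge0. Qed.

Lemma mxbndZ s M : mxbnd (s *: M) = `|s| * mxbnd M.
Proof. by rewrite /mxbnd normrZ mulrCA. Qed.

Lemma norm_mul_mxbnd M N : `|M * N| <= mxbnd M * `|N|.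
Proof. exact: norm_mulmx. Qed.

Lemma norm_mxX_mul M i (Y : mx) : `|M ^+ i * Y| <= mxbnd M ^+ i * `|Y|.
Proof.
elim: i => [|i IH]; first by rewrite !expr0 !mul1r.
rewrite !exprS -mulrA (le_trans (norm_mul_mxbnd _ _)) // -mulrA.
by apply: ler_wpM2l; rewrite ?mxbnd_ge0.
Qed.

Lemma norm_mxX M i : `|M ^+ i| <= mxbnd M ^+ i.
Proof.
rewrite -[M ^+ i]mulr1 (le_trans (norm_mxX_mul _ _ _)) //.
by rewrite ler_piMr ?scalar_mx_norm_le1 // exprn_ge0 // mxbnd_ge0.
Qed.

(** The partial sums of the exponential series of [c X], as polynomials in [X]:
    real and matrix partial sums are values of the same polynomial. *)
Definition exp_poly (c : R) k : {poly R} := \poly_(i < k) (c ^+ i / i`!%:R).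

Lemma horner_mx_sum M (p : {poly R}) k : (size p <= k)%N ->
  horner_mx M p = \sum_(i < k) p`_i *: M ^+ i.
Proof.
move=> pk; rewrite -{1}(coefK p) poly_def.
have -> : \sum_(i < size p) p`_i *: 'X^i = \sum_(i < k) p`_i *: 'X^i.
  rewrite (big_ord_widen k (fun i => p`_i *: 'X^i) pk).
  rewrite [RHS](bigID (fun i : 'I_k => (i < size p)%N)) /=.
  rewrite [X in _ = _ + X]big1 ?addr0 // => i.
  by rewrite -leqNgt => /leq_sizeP/(_ i (leqnn _)) ->; rewrite scale0r.
rewrite raddf_sum /=; apply: eq_bigr => i _.
by rewrite linearZ /= rmorphXn /= horner_mx_X.
Qed.

(** Majorant principle: a polynomial in a matrix is bounded by the value of any
    coefficientwise majorant at the norm. It transfers estimates from the real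
    exponential to the matrix exponential. *)
Lemma norm_horner_mx_mul M (p q : {poly R}) (Y : mx) :
  (forall i, `|p`_i| <= q`_i) -> `|horner_mx M p * Y| <= q.[mxbnd M] * `|Y|.
Proof.
move=> pq; have spq : (size p <= size q)%N.
  apply/leq_sizeP => j sj; apply/eqP; rewrite -normr_le0.
  by rewrite (le_trans (pq j)) // nth_default.
rewrite (horner_mx_sum M spq) horner_coef !mulr_suml.
apply: le_trans (ler_norm_sum _ _ _) _; apply: ler_sum => i _.
by rewrite -scalerAl normrZ -mulrA ler_pM // norm_mxX_mul.
Qed.

Lemma norm_horner_mx M (p q : {poly R}) :
  (forall i, `|p`_i| <= q`_i) -> `|horner_mx M p| <= q.[mxbnd M].
Proof.
move=> pq; rewrite -[horner_mx M p]mulr1.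
rewrite (le_trans (norm_horner_mx_mul _ _ pq)) //.
rewrite ler_piMr ?scalar_mx_norm_le1 // horner_coef sumr_ge0 // => i _.
by rewrite mulr_ge0 ?exprn_ge0 ?mxbnd_ge0 // (le_trans _ (pq i)).
Qed.

Lemma exp_seriesE s M k :
  series (fun i => i`!%:R^-1 *: (s *: M) ^+ i) k = horner_mx M (exp_poly s k).
Proof.
rewrite (horner_mx_sum M (size_poly _ _)) /series /= big_mkord.
apply: eq_bigr => i _; rewrite coef_poly ltn_ord.
by rewrite exprZn scalerA mulrC.
Qed.

Lemma exp_series_scalarE s u k :
  series (exp_coeff (s * u)) k = (exp_poly s k).[u].
Proof.
rewrite (horner_coef_wide _ (size_poly _ _)) /series /= big_mkord.
apply: eq_bigr => i _; rewrite coef_poly ltn_ord /exp_coeff /=.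
by rewrite exprMn mulrAC.
Qed.

Lemma mxexp_cvg M :
  series (fun i => i`!%:R^-1 *: M ^+ i) @ \oo --> mxexp M.
Proof.
apply/cvg_ex; exists (\matrix_(i, j)
  limn (series (fun k => (k`!%:R^-1 *: M ^+ k) i j))).
apply/cvg_mxP => i j; rewrite mxE.
have -> : (fun l => series (fun k => k`!%:R^-1 *: M ^+ k) l i j) =
          series (fun k => (k`!%:R^-1 *: M ^+ k) i j).
  by apply/funext => l; rewrite /series /= summxE.
apply: normed_cvg.
apply: (@series_le_cvg _ _ (exp_coeff (mxbnd M))) => [k|k|k|] //=.
- by rewrite /exp_coeff /= divr_ge0 // exprn_ge0 // mxbnd_ge0.
- rewrite (le_trans (ler_entry_norm _ _ _)) // normrZ mulrC.
  by rewrite ger0_norm ?invr_ge0 // /exp_coeff /= ler_pM2r ?norm_mxX //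
    invr_gt0 ltr0n fact_gt0.
- exact: is_cvg_series_exp_coeff.
Qed.

Lemma mxexpZ_cvg s M : (fun k => horner_mx M (exp_poly s k)) @ \oo --> mxexp (s *: M).
Proof.
by under eq_fun do rewrite -exp_seriesE; exact: mxexp_cvg.
Qed.

Lemma expR_poly_cvg s u : (fun k => (exp_poly s k).[u]) @ \oo --> expR (s * u).
Proof.
under eq_fun do rewrite -exp_series_scalarE.
exact: is_cvg_series_exp_coeff.
Qed.

(** The error made by the partial sums in the functional equation of [exp]. *)
Definition exp_defect s t k : {poly R} :=
  exp_poly s k * exp_poly t k - exp_poly (s + t) k.

(** Below degree [k] the defect vanishes by the binomial theorem; from degree [k]
    on, only the product contributes, and its coefficients at [`|s|] and [`|t|]
    dominate those at [s] and [t]. Hence the real functional equation implies the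
    matrix one. *)
Lemma exp_defect_coef s t k i :
  `|(exp_defect s t k)`_i| <= (exp_defect `|s| `|t| k)`_i.
Proof.
have low (a b : R) : (i < k)%N -> (exp_defect a b k)`_i = 0.
  move=> ik; rewrite /exp_defect coefB coefM coef_poly ik exprDn.
  apply/eqP; rewrite subr_eq0 mulr_suml; apply/eqP.
  rewrite [RHS](reindex_inj rev_ord_inj) /=.
  apply: eq_bigr => j _; rewrite !coef_poly.
  have ji : (j <= i)%N by rewrite -ltnS.
  rewrite (leq_ltn_trans ji ik) (leq_ltn_trans (leq_subr _ _) ik).
  rewrite subSS subKn // -mulr_natr bin_sub //.
  rewrite -(bin_fact ji) !natrM.
  have := fact_gt0 j; have := fact_gt0 (i - j).
  have := bin_gt0 i j; rewrite ji -!(ltr0n R).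
  by move=> /lt0r_neq0 h1 /lt0r_neq0 h2 /lt0r_neq0 h3; field; rewrite h1 h2 h3.
have [ik|ki] := ltnP i k; first by rewrite !low // normr0.
rewrite /exp_defect !coefB !coefM !coef_poly ltnNge ki /= !subr0.
apply: le_trans (ler_norm_sum _ _ _) _; apply: ler_sum => j _.
rewrite normrM !coef_poly; apply: ler_pM => //.
  by case: ifP; rewrite ?normr0 // normrM normrX normfV !normr_nat.
by case: ifP; rewrite ?normr0 // normrM normrX normfV !normr_nat.
Qed.

Lemma mxexpD s t M : mxexp ((s + t) *: M) = mxexp (s *: M) * mxexp (t *: M).
Proof.
apply/eqP; rewrite eq_sym -subr_eq0; apply/eqP.
have h1 : (fun k => horner_mx M (exp_defect s t k)) @ \oo -->
    mxexp (s *: M) * mxexp (t *: M) - mxexp ((s + t) *: M).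
  under eq_fun do rewrite rmorphB rmorphM /=.
  apply: cvgB; last exact: mxexpZ_cvg.
  by apply: cvg_mulmx; exact: mxexpZ_cvg.
have h2 : (fun k => horner_mx M (exp_defect s t k)) @ \oo --> (0 : mx).
  apply: (@cvg_dist_bound _ _ _ _
    (fun k => (exp_defect `|s| `|t| k).[mxbnd M])).
    by move=> k; rewrite subr0; apply: norm_horner_mx => i; exact: exp_defect_coef.
  under eq_fun do rewrite hornerD hornerN hornerM.
  rewrite -(subrr (expR ((`|s| + `|t|) * mxbnd M))) {1}mulrDl expRD.
  apply: cvgB; last exact: expR_poly_cvg.
  by apply: cvgM; exact: expR_poly_cvg.
exact: cvg_mx_unique h1 h2.
Qed.

Lemma mxexp0 : mxexp (0 : mx) = 1.
Proof.
suff h : series (fun i => i`!%:R^-1 *: (0 : mx) ^+ i) @ \oo --> (1 : mx).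
  exact: cvg_mx_unique (@mxexp_cvg 0) h.
apply: cvg_near_cst; exists 1%N => // k /= k1.
rewrite /series /= big_mkord -(prednK k1) big_ord_recl /= fact0 invr1 scale1r.
rewrite expr0 big1 ?addr0 // => i _.
by rewrite /bump /= exprS mul0r scaler0.
Qed.

Lemma mxexpN s M : mxexp (- s *: M) * mxexp (s *: M) = 1.
Proof. by rewrite -mxexpD addNr scale0r mxexp0. Qed.

Lemma mxexp_mulrn s M i : mxexp ((i%:R * s) *: M) = mxexp (s *: M) ^+ i.
Proof.
elim: i => [|i IH]; first by rewrite mul0r scale0r mxexp0.
by rewrite exprS -IH -mxexpD mulrSr mulrDl mul1r addrC.
Qed.

Lemma mxexp_conj M (P Q : mx) : Q * P = 1 -> mxexp (P * M * Q) = P * mxexp M * Q.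
Proof.
move=> QP; suff h : series (fun i => i`!%:R^-1 *: (P * M * Q) ^+ i) @ \oo -->
    P * mxexp M * Q.
  exact: cvg_mx_unique (@mxexp_cvg _) h.
have -> : series (fun i => i`!%:R^-1 *: (P * M * Q) ^+ i) =
  (fun k => P *m series (fun i => i`!%:R^-1 *: M ^+ i) k *m Q).
  apply/funext => k; rewrite /series /= mulmx_sumr mulmx_suml.
  apply: eq_bigr => i _; rewrite -scalemxAr -scalemxAl; congr (_ *: _).
  have PQ : P * Q = 1 by apply: mulmx1C.
  elim: i => [|i IH]; first by rewrite !expr0 !mulmxE mulr1.
  by rewrite !exprS IH !mulmxE !mulrA -[_ * Q * P]mulrA QP mulr1.
apply: cvg_mulmx; last exact: cvg_cst.
by apply: cvg_mulmx; [exact: cvg_cst|exact: mxexp_cvg].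
Qed.

Lemma exp_partial_sum_le (x : R) k : 0 <= x -> series (exp_coeff x) k <= expR x.
Proof.
move=> x0; apply: nondecreasing_cvgn_le (is_cvg_series_exp_coeff _) _.
apply: nondecreasing_series => i _ _.
by rewrite /exp_coeff /= divr_ge0 // exprn_ge0.
Qed.

(** The factor [Y] is kept so that iterating the bound costs no dimensional
    constant: the maximum norm is only submultiplicative up to the dimension. *)
Lemma norm_mxexp_mul M (Y : mx) : `|mxexp M * Y| <= expR (mxbnd M) * `|Y|.
Proof.
rewrite -{1}[M]scale1r.
have cv : (fun k => horner_mx M (exp_poly 1 k) * Y) @ \oo -->
    mxexp (1 *: M) * Y.
  by apply: cvg_mulmx; [exact: mxexpZ_cvg|exact: cvg_cst].
apply: (@limn_norm_le R mx _ _ _ cv) => k.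
have := @norm_horner_mx_mul M (exp_poly 1 k) (exp_poly 1 k) Y.
move=> /(_ _)/le_trans; apply.
  move=> i; rewrite coef_poly; case: ifP; rewrite ?normr0 // => _.
  by rewrite ger0_norm // divr_ge0 // exprn_ge0.
rewrite ler_wpM2r // -exp_series_scalarE mul1r.
exact: exp_partial_sum_le (mxbnd_ge0 M).
Qed.

Lemma mxexp_remainder M :
  `|mxexp M - 1 - M| <= mxbnd M ^+ 2 * expR (mxbnd M).
Proof.
pose S k := series (fun i => i`!%:R^-1 *: M ^+ i) k.
have SM : (fun k => S (k + 2)%N - 1 - M) @ \oo --> mxexp M - 1 - M.
  apply: cvgB; last exact: cvg_cst.
  apply: cvgB; last exact: cvg_cst.
  by rewrite cvg_shiftn; exact: mxexp_cvg.
apply: (@limn_norm_le R mx _ _ _ SM) => k.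
rewrite /S /series /= big_mkord addn2 big_ord_recl big_ord_recl /=.
rewrite fact0 !invr1 !scale1r expr0 expr1.
rewrite (_ : forall A B C : mx, A + (B + C) - A - B = C); last first.
  by move=> A B C; rewrite [A + _]addrC addrK [B + C]addrC addrK.
apply: le_trans (ler_norm_sum _ _ _) _.
apply: (@le_trans _ _ (mxbnd M ^+ 2 * series (exp_coeff (mxbnd M)) k)).
  rewrite /series /= big_mkord mulr_sumr; apply: ler_sum => i _.
  rewrite normrZ /exp_coeff /= mulrA -exprD mulrC.
  apply: ler_pM => //; first by rewrite norm_mxX.
  rewrite ger0_norm ?invr_ge0 // lef_pV2 ?posrE ?ltr0n ?fact_gt0 //.
  by rewrite ler_nat; apply: leq_fact; rewrite !leqW.
apply: ler_wpM2l; first by rewrite exprn_ge0 // mxbnd_ge0.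
exact: exp_partial_sum_le (mxbnd_ge0 M).
Qed.

End MatrixExponential.

(** * Euler products and continuity of the exponential *)

Section EulerLimit.
Context {R : realType} {n : nat}.
Notation mx := 'M[R]_n.+1.
Implicit Types (M N : mx) (s t u : R).

Lemma cvg_expR (f : nat -> R) a : f @ \oo --> a -> (fun j => expR (f j)) @ \oo --> expR a.
Proof. by move=> fa; apply: continuous_cvg fa; exact: continuous_expR. Qed.

Lemma cvg_mxbnd (u : nat -> mx) M : u @ \oo --> M ->
  (fun j => mxbnd (u j)) @ \oo --> mxbnd M.
Proof. by move=> uM; apply: cvgMr; exact: cvg_norm. Qed.

Lemma cvg_normr (f : nat -> R) a : f @ \oo --> a -> (fun j => `|f j|) @ \oo --> `|a|.
Proof. by move=> fa; exact: cvg_norm. Qed.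

Lemma mxexp_remainderZ s M :
  `|mxexp (s *: M) - 1 - s *: M| <=
  `|s| * (`|s| * mxbnd M ^+ 2 * expR (`|s| * mxbnd M)).
Proof.
by rewrite (le_trans (mxexp_remainder _)) // mxbndZ exprMn expr2 !mulrA.
Qed.

(** The derivative of the exponential at the origin, along a moving direction:
    letting [u] vary also yields the continuity of [mxexp]. *)
Lemma cvg_mxexp_quotient (d : nat -> R) (u : nat -> mx) M :
  (forall j, d j != 0) -> d @ \oo --> 0 -> u @ \oo --> M ->
  (fun j => (d j)^-1 *: (mxexp (d j *: u j) - 1)) @ \oo --> M.
Proof.
move=> d0 dc uM.
have key : (fun j => (d j)^-1 *: (mxexp (d j *: u j) - 1) - u j) @ \oo --> (0 : mx).
  apply: (@cvg_dist_bound _ _ _ _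
    (fun j => `|d j| * mxbnd (u j) ^+ 2 * expR (`|d j| * mxbnd (u j)))).
    move=> j; rewrite subr0.
    have -> : (d j)^-1 *: (mxexp (d j *: u j) - 1) - u j =
       (d j)^-1 *: (mxexp (d j *: u j) - 1 - d j *: u j).
      by rewrite [in RHS]scalerBr scalerK.
    rewrite normrZ normfV ler_pdivrMl ?normr_gt0 //.
    exact: mxexp_remainderZ.
  have -> : (0 : R) = `|0 : R| * mxbnd M ^+ 2 * expR (`|0 : R| * mxbnd M).
    by rewrite normr0 !mul0r.
  apply: cvgM.
    apply: cvgM; first by refine (@cvg_normr _ _ _).
    rewrite expr2; under eq_fun do rewrite expr2.
    by apply: cvgM; refine (@cvg_mxbnd _ _ uM).
  refine (@cvg_expR _ _ _); apply: cvgM; first by refine (@cvg_normr _ _ _).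
  refine (@cvg_mxbnd _ _ uM).
exact (cvg_sub0 key uM).
Qed.

Lemma cvg_mxexpZ (d : nat -> R) s M : d @ \oo --> s ->
  (fun j => mxexp (d j *: M)) @ \oo --> mxexp (s *: M).
Proof.
move=> ds.
suff h : (fun j => mxexp ((d j - s) *: M)) @ \oo --> (1 : mx).
  under eq_fun => j do rewrite -(subrK s (d j)) addrC mxexpD.
  suff : (fun j => mxexp (s *: M) *m mxexp ((d j - s) *: M)) @ \oo -->
      mxexp (s *: M) *m 1 by rewrite mulmx1.
  by apply: cvg_mulmx h; exact: cvg_cst.
have d0 : (fun j => d j - s) @ \oo --> (0 : R).
  by rewrite -(subrr s); apply: cvgB => //; exact: cvg_cst.
apply: (@cvg_dist_bound _ _ _ _ (fun j => `|d j - s| * `|M| +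
  `|d j - s| * (`|d j - s| * mxbnd M ^+ 2 * expR (`|d j - s| * mxbnd M)))).
  move=> j; rewrite -normrZ.
  have -> : mxexp ((d j - s) *: M) - 1 =
    (d j - s) *: M + (mxexp ((d j - s) *: M) - 1 - (d j - s) *: M).
    by rewrite [RHS]addrC subrK.
  rewrite (le_trans (ler_normD _ _)) // lerD2l.
  exact: mxexp_remainderZ.
have -> : (0 : R) = `|0 : R| * `|M| + `|0 : R| * (`|0 : R| * mxbnd M ^+ 2 * expR (`|0 : R| * mxbnd M)).
  by rewrite normr0 !mul0r addr0.
apply: cvgD.
  by apply: cvgM; [by refine (@cvg_normr _ _ _)|exact: cvg_cst].
apply: cvgM; first by refine (@cvg_normr _ _ _).
apply: cvgM.
  by apply: cvgM; [by refine (@cvg_normr _ _ _)|exact: cvg_cst].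
refine (@cvg_expR _ _ _); apply: cvgM; first by refine (@cvg_normr _ _ _).
exact: cvg_cst.
Qed.

(** Telescoping [A ^+ k - B ^+ k]. The hypotheses bound multiplication operators
    rather than the matrices, so that [c ^+ k] stays bounded when [c] is close to
    one and [k] is large. *)
Lemma norm_exprB_le (A B : mx) (c : R) k : 1 <= c ->
  (forall Y, `|A * Y| <= c * `|Y|) -> (forall Y, `|B * Y| <= c * `|Y|) ->
  `|A ^+ k - B ^+ k| <= k%:R * mxbnd (A - B) * c ^+ k.
Proof.
move=> c1 Ac Bc; have c0 : 0 <= c by apply: le_trans c1.
have BX i : `|B ^+ i| <= c ^+ i.
  elim: i => [|i IH]; first by rewrite !expr0; exact: scalar_mx_norm_le1.
  by rewrite !exprS (le_trans (Bc _)) // ler_wpM2l.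
elim: k => [|k IH]; first by rewrite !expr0 subrr normr0 !mul0r.
have -> : A ^+ k.+1 - B ^+ k.+1 = A * (A ^+ k - B ^+ k) + (A - B) * B ^+ k.
  by rewrite !exprS mulrBr mulrBl addrA subrK.
rewrite (le_trans (ler_normD _ _)) //.
rewrite -(natr1 k) [(k%:R + 1) * _]mulrDl mul1r [leRHS]mulrDl lerD //.
  by rewrite (le_trans (Ac _)) // exprS [leRHS]mulrCA ler_wpM2l.
rewrite (le_trans (norm_mul_mxbnd _ _)) // ler_wpM2l ?mxbnd_ge0 //.
by rewrite (le_trans (BX k)) // exprS ler_peMl // exprn_ge0.
Qed.

(** Each factor differs from [mxexp (d j *: M)] by [o (d j)], and there are
    [O (1 / d j)] factors. *)
Lemma cvg_mx_euler (u : nat -> mx) (d : nat -> R) (k : nat -> nat) M s :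
  u @ \oo --> M -> d @ \oo --> 0 -> (fun j => (k j)%:R * d j) @ \oo --> s ->
  (fun j => (1 + d j *: u j) ^+ k j) @ \oo --> mxexp (s *: M).
Proof.
move=> uM d0 kds.
suff h : (fun j => (1 + d j *: u j) ^+ k j - mxexp (((k j)%:R * d j) *: M))
    @ \oo --> (0 : mx).
  exact (cvg_sub0 h (@cvg_mxexpZ _ _ M kds)).
pose x j := mxbnd (u j) + mxbnd M.
pose rem j := `|u j - M| + `|d j| * mxbnd M ^+ 2 * expR (`|d j| * mxbnd M).
apply: (@cvg_dist_bound _ _ _ _ (fun j => n.+1%:R * `|(k j)%:R * d j| *
   rem j * expR (`|(k j)%:R * d j| * x j))).
  move=> j; rewrite subr0 mxexp_mulrn.
  have ge0 := mxbnd_ge0 (u j); have ge0M := mxbnd_ge0 M.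
  apply: le_trans (@norm_exprB_le _ _ (expR (`|d j| * x j)) _ _ _ _) _.
  - by rewrite -expR0 ler_expR mulr_ge0 // addr_ge0.
  - move=> Y; rewrite mulrDl mul1r (le_trans (ler_normD _ _)) //.
    rewrite -scalerAl normrZ.
    apply: (@le_trans _ _ ((1 + `|d j| * mxbnd (u j)) * `|Y|)).
      by rewrite mulrDl mul1r lerD2l -mulrA ler_wpM2l // norm_mul_mxbnd.
    rewrite ler_wpM2r // (le_trans (expR_ge1Dx _)) // ler_expR.
    by rewrite ler_wpM2l // lerDl.
  - move=> Y.
    rewrite (le_trans (norm_mxexp_mul _ _)) // ler_wpM2r // ler_expR mxbndZ.
    by rewrite ler_wpM2l // lerDr.
  - have -> : expR (`|d j| * x j) ^+ k j = expR (`|(k j)%:R * d j| * x j).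
      by rewrite -expRM_natl mulrA normrM normr_nat.
    rewrite ler_wpM2r ?expR_ge0 // /mxbnd normrM normr_nat mulrCA -!mulrA.
    rewrite !ler_wpM2l //.
    have -> : 1 + d j *: u j - mxexp (d j *: M) =
        d j *: (u j - M) - (mxexp (d j *: M) - 1 - d j *: M).
      rewrite scalerBr; move: (d j *: u j) (d j *: M) (mxexp _) => a b e.
      by rewrite opprB addrA subrK opprB addrA [a + 1]addrC.
    rewrite (le_trans (ler_normB _ _)) // normrZ /rem mulrDr lerD2l.
    exact: mxexp_remainderZ.
have -> : (0 : R) = n.+1%:R * `|s| *
    (`|0 : mx| + `|0 : R| * mxbnd M ^+ 2 * expR (`|0 : R| * mxbnd M)) *
    expR (`|s| * (mxbnd M + mxbnd M)).
  by rewrite !normr0 !mul0r addr0 mulr0 mul0r.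
apply: cvgM; last first.
  refine (@cvg_expR _ _ _); apply: cvgM; first by refine (@cvg_normr _ _ _).
  by apply: cvgD; [refine (@cvg_mxbnd _ _ uM)|exact: cvg_cst].
apply: cvgM.
  by apply: cvgM; [exact: cvg_cst|by refine (@cvg_normr _ _ _)].
apply: cvgD.
  by apply: cvg_norm; rewrite -(subrr M); apply: cvgB => //; exact: cvg_cst.
apply: cvgM.
  by apply: cvgM; [by refine (@cvg_normr _ _ _)|exact: cvg_cst].
refine (@cvg_expR _ _ _); apply: cvgM; first by refine (@cvg_normr _ _ _).
exact: cvg_cst.
Qed.

(** [mxexp (u j)] is the [j.+1]-th power of [mxexp (u j / j.+1)], whose
    difference quotient at the identity tends to [M]: Euler's limit applies. *)
Lemma cvg_mxexp (u : nat -> mx) M : u @ \oo --> M ->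
  (fun j => mxexp (u j)) @ \oo --> mxexp M.
Proof.
move=> uM; pose d j : R := j.+1%:R^-1.
have d0 j : d j != 0 by rewrite invr_eq0 pnatr_eq0.
have dc : d @ \oo --> 0 by exact: cvg_harmonic.
have q := cvg_mxexp_quotient d0 dc uM.
have kd : (fun j => j.+1%:R * d j) @ \oo --> (1 : R).
  by apply: cvg_near_cst; apply: nearW => j; rewrite divff ?pnatr_eq0.
have := @cvg_mx_euler _ _ (fun j => j.+1) _ _ q dc kd; rewrite scale1r.
suff -> : (fun j => (1 + d j *: ((d j)^-1 *: (mxexp (d j *: u j) - 1))) ^+ j.+1)
  = (fun j => mxexp (u j)) by [].
apply/funext => j.
rewrite scalerA divff // scale1r addrC subrK -mxexp_mulrn.
by rewrite divff ?pnatr_eq0 // scale1r.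
Qed.

End EulerLimit.

(** * Measurability of random matrices *)

Section RandomMatrices.
Context {d : measure_display} {T : measurableType d} {R : realType}.

Lemma measurable_open_mx n k (U : set 'M[R]_(n, k)) :
  open U -> measurable (U : set (borel_mx R n k)).
Proof. by move=> oU; apply: sub_sigma_algebra. Qed.

Lemma measurable_closed_mx n k (F : set 'M[R]_(n, k)) :
  closed F -> measurable (F : set (borel_mx R n k)).
Proof.
move=> cF; rewrite -[F]setCK; apply: measurableC.
by apply: measurable_open_mx; exact: closed_openC.
Qed.

Lemma measurable_mx_entry n k (V : T -> borel_mx R n k) i j :
  measurable_fun setT V -> measurable_fun setT (fun w => (V w : 'M[R]_(n, k)) i j).
Proof.
move=> mV.
have mc : measurable_fun setT (fun M : borel_mx R n k => (M : 'M[R]_(n, k)) i j).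
  apply: (measurability _ (RGenOpens.measurableE R)) => _ [_ [a [b ->]] <-].
  rewrite setTI; apply: measurable_open_mx.
  apply: (@open_comp _ _ (fun M : 'M[R]_(n, k) => M i j)).
    by move=> M _; exact: coord_continuous.
  exact: interval_open.
exact: measurableT_comp mc mV.
Qed.

(** A random matrix is measurable as soon as its entries are: an open set is a
    countable union of boxes with rational centres and radii [1 / N.+1]. *)
Lemma measurable_mx n k (V : T -> borel_mx R n k) :
  (forall i j, measurable_fun setT (fun w => (V w : 'M[R]_(n, k)) i j)) ->
  measurable_fun setT V.
Proof.
move=> mV.
apply: (@measurability _ _ T (borel_mx R n k) setT V (@open 'M[R]_(n, k)) erefl) => _ [U oU <-].
rewrite setTI.
pose box (Q : 'M[rat]_(n, k) * nat) :=
  [set M : 'M[R]_(n, k) | forall i j, `|M i j - ratr (Q.1 i j)| < Q.2.+1%:R^-1].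
pose W (Q : 'M[rat]_(n, k) * nat) := if `[< box Q `<=` U >] then V @^-1` box Q else set0.
have -> : V @^-1` U = \bigcup_Q W Q.
  apply/seteqP; split => [w Uw|w [Q _]]; last first.
    by rewrite /W; case: asboolP => // sub /sub.
  have /nbhs_ballP[e /= e0 ballU] : nbhs (V w : 'M[R]_(n, k)) U by exact: open_nbhs_nbhs.
  have [N Ne] : exists N, N.+1%:R^-1 + N.+1%:R^-1 < e.
    have e2 : 0 < e / 2 by rewrite divr_gt0.
    have [N Ne] := ltr_add_invr e2; rewrite add0r in Ne.
    by exists N; rewrite [ltRHS](splitr e) ltrD.
  have rq i j : exists q : rat, `|(V w : 'M[R]_(n, k)) i j - ratr q| < N.+1%:R^-1.
    have b0 : ball ((V w : 'M[R]_(n, k)) i j) N.+1%:R^-1 !=set0.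
      by exists ((V w : 'M[R]_(n, k)) i j); exact: ballxx.
    have [x [+ [q _ qx]]] := dense_rat b0 (@ball_open _ _ _ _).
    by rewrite -ball_normE /= -qx; exists q.
  have [f fP] := choice (fun ij : 'I_n * 'I_k => rq ij.1 ij.2).
  exists (\matrix_(i, j) f (i, j), N) => //.
  rewrite /W asboolT; first by move=> i j /=; rewrite mxE; exact: (fP (i, j)).
  move=> M MQ; apply: ballU; split => // i j; rewrite -ball_normE /=.
  rewrite -(subrKA (ratr (f (i, j)))) (le_lt_trans (ler_normD _ _)) //.
  rewrite (lt_trans _ Ne) // ltrD //; first exact: (fP (i, j)).
  by have := MQ i j; rewrite /= mxE distrC.
apply: countable_bigcupT_measurable => [|Q]; first exact: countableP.
rewrite /W.
case: asboolP => // _.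
have -> : V @^-1` box Q = \bigcap_(i in [set: 'I_n]) \bigcap_(j in [set: 'I_k])
   ((fun w => (V w : 'M[R]_(n, k)) i j) @^-1` ball (ratr (Q.1 i j) : R) (Q.2.+1%:R^-1 : R)).
  apply/seteqP; split=> w /=.
    by move=> h i _ j _; rewrite /= -ball_normE /= distrC; exact: h.
  by move=> h i j; have := h i I j I; rewrite /= -ball_normE /= distrC.
apply: fin_bigcap_measurable => // i _.
apply: fin_bigcap_measurable => // j _.
rewrite -[X in measurable X]setTI; apply: mV => //; exact: measurable_ball.
Qed.

End RandomMatrices.

(** * Convergence in probability and equality in law *)

(** Random matrices keep the plain matrix type, which carries the algebra; the
    Borel structure is attached to the codomain here. *)
Definition measurable_rmx {d : measure_display} {T : measurableType d}
  {R : realType} n k (V : T -> 'M[R]_(n, k)) :=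
  measurable_fun setT (V : T -> borel_mx R n k).

Section ConvergenceInLaw.
Context {d : measure_display} {T : measurableType d} {R : realType}.
Variable P : probability T R.

Lemma measurable_rmx_entry n k (V : T -> 'M[R]_(n, k)) i j :
  measurable_rmx V -> measurable_fun setT (fun w => V w i j).
Proof. exact: measurable_mx_entry. Qed.

Lemma measurable_rmxB n k (V W : T -> 'M[R]_(n, k)) :
  measurable_rmx V -> measurable_rmx W -> measurable_rmx (fun w => V w - W w).
Proof.
move=> mV mW; apply: measurable_mx => i j.
under eq_fun do rewrite !mxE.
by apply: measurable_funB; exact: measurable_rmx_entry.
Qed.

Lemma measurable_rmx_mull p n k (A : 'M[R]_(p, n)) (V : T -> 'M[R]_(n, k)) :
  measurable_rmx V -> measurable_rmx (fun w => A *m V w).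
Proof.
move=> mV; apply: measurable_mx => i j.
under eq_fun do rewrite !mxE.
apply: measurable_sum => l; apply: measurable_funM => //.
exact: measurable_rmx_entry.
Qed.

Lemma measurable_rmx_preimage n k (V : T -> 'M[R]_(n, k))
    (B : set (borel_mx R n k)) :
  measurable_rmx V -> measurable B -> measurable (V @^-1` B).
Proof. by move=> mV mB; rewrite -[X in measurable X]setTI; exact: mV. Qed.

Lemma closed_norm_ge n k (e : R) : closed [set M : 'M[R]_(n, k) | e <= `|M|].
Proof.
have -> : [set M : 'M[R]_(n, k) | e <= `|M|] = Num.norm @^-1` [set x : R | e <= x].
  by [].
apply: preimage_closed (@closed_ge R e) => x _; exact: norm_continuous.
Qed.

Lemma measurable_norm_ge n k (V : T -> 'M[R]_(n, k)) (e : R) :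
  measurable_rmx V -> measurable [set w | e <= `|V w|].
Proof.
move=> mV; exact: (@measurable_rmx_preimage n k V [set M | e <= `|M|] mV
  (measurable_closed_mx (@closed_norm_ge n k e))).
Qed.

Definition law_eq n k (V W : T -> 'M[R]_(n, k)) :=
  forall B : set (borel_mx R n k), measurable B -> P (V @^-1` B) = P (W @^-1` B).

Definition cvg_prob n k (V_ : nat -> T -> 'M[R]_(n, k)) (V : T -> 'M[R]_(n, k)) :=
  forall e : R, 0 < e -> (fun j => P [set w | e <= `|V_ j w - V w|]) @ \oo --> 0%E.

Definition thickening n k (F : set 'M[R]_(n, k)) (r : R) : set 'M[R]_(n, k) :=
  \bigcup_(y in F) ball y r.

Lemma open_thickening n k (F : set 'M[R]_(n, k)) r : open (thickening F r).
Proof. by apply: bigcup_open => y _; exact: ball_open. Qed.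

Lemma bigcap_thickening n k (F : set 'M[R]_(n, k)) : closed F ->
  \bigcap_j thickening F j.+1%:R^-1 = F.
Proof.
move=> cF; apply/seteqP; split=> [x xF|x Fx j _]; last first.
  by exists x => //; exact: ballxx.
apply: cF => A /nbhs_ballP[e /= e0 eA].
have [N Ne] := ltr_add_invr e0; rewrite add0r in Ne.
have [y Fy yx] := xF N I.
by exists y; split => //; apply: eA; apply: le_ball (ltW Ne) _ _; exact: ball_sym.
Qed.

Section Limit.
Variables (n k : nat) (V_ W_ : nat -> T -> 'M[R]_(n, k)) (V W : T -> 'M[R]_(n, k)).
Hypotheses (mV_ : forall j, measurable_rmx (V_ j)) (mV : measurable_rmx V).
Hypotheses (mW_ : forall j, measurable_rmx (W_ j)) (mW : measurable_rmx W).
Hypotheses (VV : cvg_prob V_ V) (WW : cvg_prob W_ W).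
Hypothesis VW : forall j, law_eq (V_ j) (W_ j).

(** If [V] lies in [F] then, up to the small event that [V_ j] is far from [V],
    [V_ j] lies in the [r]-thickening of [F]; so does [W_ j] with the same
    probability, and then [W] lies in the [2r]-thickening. Let [j] tend to
    infinity, then [r] to zero. *)
Lemma law_le_closed (F : set 'M[R]_(n, k)) : closed F ->
  (P (V @^-1` F) <= P (W @^-1` F))%E.
Proof.
move=> cF.
have mF r : measurable (thickening F r : set (borel_mx R n k)).
  apply: measurable_open_mx; exact: open_thickening.
have step (r : R) : 0 < r ->
    (P (V @^-1` F) <= P (W @^-1` (thickening F (r + r)%R)))%E.
  move=> r0.
  have mVr j : measurable [set w | r <= `|V_ j w - V w|].
    exact: measurable_norm_ge (measurable_rmxB (mV_ j) mV).
  have mWr j : measurable [set w | r <= `|W_ j w - W w|].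
    exact: measurable_norm_ge (measurable_rmxB (mW_ j) mW).
  have mWt : measurable (W @^-1` (thickening F (r + r))).
    exact: measurable_rmx_preimage.
  have bnd j : (P (V @^-1` F) <= P (W @^-1` (thickening F (r + r)%R)) +
     (P [set w | (r <= `|V_ j w - V w|)%R] + P [set w | (r <= `|W_ j w - W w|)%R]))%E.
    apply: (@le_trans _ _ (P (V_ j @^-1` (thickening F r)) +
                           P [set w | (r <= `|V_ j w - V w|)%R])%E).
      apply: le_trans (measureU2 _ _ _) => //; last exact: measurable_rmx_preimage.
      apply: le_measure; rewrite ?inE.
      - by apply: measurable_rmx_preimage mV _; exact: measurable_closed_mx.
      - by apply: measurableU => //; exact: measurable_rmx_preimage.
      move=> w Fw; have [|lt] := leP r `|V_ j w - V w|; [by right|left].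
      by exists (V w) => //; rewrite -ball_normE /= distrC.
    rewrite (addeC (P [set w | (r <= `|V_ j w - V w|)%R])) addeA leeD2r //.
    rewrite (VW j (mF r)).
    apply: le_trans (measureU2 _ _ _) => //.
    apply: le_measure; rewrite ?inE.
    - exact: measurable_rmx_preimage.
    - exact: measurableU.
    move=> w [y Fy yw]; have [|lt] := leP r `|W_ j w - W w|; [by right|left].
    by exists y => //; apply: ball_triangle yw _; rewrite -ball_normE.
  have lim : (fun j => P (W @^-1` (thickening F (r + r)%R)) +
     (P [set w | (r <= `|V_ j w - V w|)%R] + P [set w | (r <= `|W_ j w - W w|)%R]))%E
      @ \oo --> P (W @^-1` (thickening F (r + r)%R)).
    rewrite -[X in _ --> X]adde0; apply: cvgeD => //.
    - by rewrite fin_num_adde_defl.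
    - exact: cvg_cst.
    rewrite -[X in _ --> X]adde0; apply: cvgeD => //; [exact: VV|exact: WW].
  by apply: (cvge_to_ge lim); exact: nearW.
have cap : W @^-1` F = \bigcap_j W @^-1` (thickening F j.+1%:R^-1).
  by rewrite -preimage_bigcap bigcap_thickening.
have lim : (P \o (fun j => W @^-1` (thickening F j.+1%:R^-1))) @ \oo --> P (W @^-1` F).
  rewrite cap; apply: nonincreasing_cvg_mu => //.
  - by rewrite ltey_eq fin_num_measure //; exact: measurable_rmx_preimage.
  - by move=> j; exact: measurable_rmx_preimage.
  - by rewrite -cap; apply: measurable_rmx_preimage mW _; exact: measurable_closed_mx.
  - move=> i j ij; apply/subsetPset => w [y Fy yw]; exists y => //.
    by apply: le_ball yw; rewrite lef_pV2 ?posrE // ler_nat.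
apply: (cvge_to_ge lim); apply: nearW => j /=.
have -> : j.+1%:R^-1 = (j.+1%:R^-1 / 2 + j.+1%:R^-1 / 2 : R) by rewrite -splitr.
by apply: step; rewrite divr_gt0.
Qed.

End Limit.

(** Complements of closed sets form a pi-system generating the Borel sets. *)
Lemma law_eq_closed n k (V W : T -> 'M[R]_(n, k)) :
  measurable_rmx V -> measurable_rmx W ->
  (forall F, closed F -> P (V @^-1` F) = P (W @^-1` F)) -> law_eq V W.
Proof.
move=> mV mW VWF.
pose V' : T -> borel_mx R n k := V; pose W' : T -> borel_mx R n k := W.
have mV' : measurable_fun setT V' by [].
have mW' : measurable_fun setT W' by [].
pose mu : {measure set (borel_mx R n k) -> \bar R} :=
  distribution P (mfun_Sub (mem_set mV')).
pose nu : {measure set (borel_mx R n k) -> \bar R} :=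
  distribution P (mfun_Sub (mem_set mW')).
have := @measure_unique _ R (borel_mx R n k) (@open 'M[R]_(n, k)) (fun=> setT) erefl.
move=> /(_ _ _ _ mu nu) uni B mB.
apply: uni mB => //.
- by move=> A A' oA oA'; exact: openI.
- by move=> _; exact: openT.
- exact: bigcup_const.
- move=> A oA.
  have mA : measurable (A : set (borel_mx R n k)) by exact: measurable_open_mx.
  have mVA := measurable_rmx_preimage mV mA.
  have mWA := measurable_rmx_preimage mW mA.
  change (P (V @^-1` A) = P (W @^-1` A)).
  rewrite -[V @^-1` A]setCK -[W @^-1` A]setCK.
  rewrite (probability_setC P (measurableC mVA)).
  rewrite (probability_setC P (measurableC mWA)).
  congr (1 - _)%E.
  exact: (VWF _ (open_closedC oA)).
- move=> _; change (P (V @^-1` [set: 'M[R]_(n, k)]) < +oo)%E.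
  by rewrite preimage_setT probability_setT ltry.
Qed.

Lemma law_eq_lim n k (V_ W_ : nat -> T -> 'M[R]_(n, k)) (V W : T -> 'M[R]_(n, k)) :
  (forall j, measurable_rmx (V_ j)) -> measurable_rmx V ->
  (forall j, measurable_rmx (W_ j)) -> measurable_rmx W ->
  cvg_prob V_ V -> cvg_prob W_ W -> (forall j, law_eq (V_ j) (W_ j)) -> law_eq V W.
Proof.
move=> mV_ mV mW_ mW VV WW VW; apply: law_eq_closed => // F cF.
apply/eqP; rewrite eq_le; apply/andP; split.
  exact: (law_le_closed mV_ mV mW_ mW VV WW VW).
by apply: (law_le_closed mW_ mW mV_ mV WW VV) => // j B mB; rewrite VW.
Qed.

End ConvergenceInLaw.

Section ConvergenceInProbability.
Context {d : measure_display} {T : measurableType d} {R : realType}.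
Variable P : probability T R.

Lemma cvg0_ereal (p : nat -> \bar R) : (forall j, (0 <= p j)%E) ->
  (forall e : R, 0 < e -> \forall j \near \oo, (p j <= e%:E)%E) ->
  p @ \oo --> 0%E.
Proof.
move=> p0 pe; apply/fine_cvgP; split.
  have := pe 1 ltr01; apply: filterS => j pj.
  by rewrite ge0_fin_numE // (le_lt_trans pj) // ltry.
apply/cvgrPdist_le => e e0; have := pe e e0; apply: filterS => j pj.
rewrite /= sub0r normrN ger0_norm ?fine_ge0 //.
have pjf : p j \is a fin_num by rewrite ge0_fin_numE // (le_lt_trans pj) // ltry.
by rewrite -lee_fin fineK.
Qed.

(** Tightness of a single law. *)
Lemma tail_small n k (V : T -> 'M[R]_(n, k)) (e : R) : measurable_rmx V -> 0 < e ->
  exists K : R, 0 < K /\ (P [set w | (K <= `|V w|)%R] <= e%:E)%E.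
Proof.
move=> mV e0.
pose F (j : nat) := [set w | j.+1%:R <= `|V w|].
have cap : \bigcap_j F j = set0.
  rewrite -subset0 => w Fw.
  have [j] : exists j : nat, `|V w| < j%:R.
    by exists (Num.bound `|V w|); exact: archi_boundP.
  rewrite ltNge => /negP; apply.
  by rewrite (le_trans _ (Fw j I)) // ler_nat.
have mF j : measurable (F j) by exact: measurable_norm_ge.
have lim : (P \o F) @ \oo --> 0%E.
  rewrite -(measure0 P) -cap; apply: nonincreasing_cvg_mu => //.
  - by rewrite ltey_eq fin_num_measure.
  - by rewrite cap.
  - move=> i j ij; apply/subsetPset => w; apply: le_trans.
    by rewrite ler_nat.
have := lim; move=> /fine_cvgP[finF /cvgrPdist_le /(_ _ e0) nearF].
have [j [Fj fj]] := filter_ex (filterI finF nearF).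
exists j.+1%:R; split => //.
rewrite sub0r normrN ger0_norm ?fine_ge0 // in fj.
by rewrite -lee_fin fineK in fj.
Qed.

Lemma measure_bigsetU_le (I : Type) (s : seq I) (A : I -> set T) :
  (forall l, measurable (A l)) ->
  (P (\big[setU/set0]_(l <- s) A l) <= \sum_(l <- s) P (A l))%E.
Proof.
move=> mA; elim: s => [|l s IH]; first by rewrite !big_nil measure0.
rewrite !big_cons; apply: le_trans (measureU2 _ _ _) _ => //.
  exact: bigsetU_measurable.
exact: leeD2l.
Qed.

Lemma cvg_prob_mull p n k (A_ : nat -> 'M[R]_(p, n)) (A : 'M[R]_(p, n))
    (V : T -> 'M[R]_(n, k)) : measurable_rmx V -> A_ @ \oo --> A ->
  cvg_prob P (fun j w => A_ j *m V w) (fun w => A *m V w).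
Proof.
move=> mV AA e e0; apply: cvg0_ereal => // eps eps0.
have [K [K0 KP]] := tail_small mV eps0.
have nA : (fun j => n%:R * `|A_ j - A| * K) @ \oo --> (0 : R).
  have -> : (0 : R) = n%:R * `|A - A| * K by rewrite subrr normr0 mulr0 mul0r.
  apply: cvgM; last exact: cvg_cst.
  apply: cvgM; first exact: cvg_cst.
  have dA : (fun j => A_ j - A) @ \oo --> A - A.
    by apply: cvgB => //; exact: cvg_cst.
  exact: cvg_norm dA.
have nA' : \forall j \near \oo, n%:R * `|A_ j - A| * K < e.
  exact: (cvgr_lt _ nA).
apply: filterS nA' => j lt; apply: le_trans KP.
have mAV (B : 'M[R]_(p, n)) := measurable_rmx_mull B mV.
apply: le_measure; rewrite ?inE.
- exact: measurable_norm_ge (measurable_rmxB (mAV _) (mAV _)).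
- exact: measurable_norm_ge.
move=> w /=; rewrite -mulmxBl => le; rewrite leNgt; apply/negP => Vw.
have lt' : `|(A_ j - A) *m V w| < e.
  apply: le_lt_trans (norm_mulmx _ _) (le_lt_trans _ lt).
  by rewrite ler_wpM2l ?mulr_ge0 // ltW.
by have := le_lt_trans le lt'; rewrite ltxx.
Qed.

End ConvergenceInProbability.

(** * Linear symmetries of finite-dimensional laws *)

Section FiniteDimensionalLaws.
Context {d : measure_display} {T : measurableType d} {R : realType}.
Variables (P : probability T R) (m n : nat).
Implicit Types (X Y Z : 'cV[R]_m -> T -> 'cV[R]_n) (A B : 'M[R]_n) (C D : 'M[R]_m).

Lemma measurable_joint X k (t : 'I_k -> 'cV[R]_m) : random_field X ->
  measurable_rmx (joint X t).
Proof.
move=> mX; apply: measurable_mx => i j; under eq_fun do rewrite mxE.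
exact: (measurable_rmx_entry i 0 (mX (t j))).
Qed.

Lemma joint_mull A X k (t : 'I_k -> 'cV[R]_m) :
  joint (fun s w => A *m X s w) t = (fun w => A *m joint X t w).
Proof.
by apply/funext => w; apply/matrixP => i j; rewrite !mxE;
  apply: eq_bigr => l _; rewrite mxE.
Qed.

Lemma joint_single X (t : 'cV[R]_m) : joint X (fun _ : 'I_1 => t) = X t.
Proof.
by apply/funext => w; apply/matrixP => i j; rewrite mxE ord1.
Qed.

Lemma fdd_eq_law X Y t : fdd_eq P X Y -> law_eq P (X t) (Y t).
Proof.
by move=> XY B mB; rewrite -(joint_single X) -(joint_single Y); exact: XY.
Qed.

Lemma fdd_eq_sym X Y : fdd_eq P X Y -> fdd_eq P Y X.
Proof. by move=> XY k t B mB; rewrite XY. Qed.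

Lemma fdd_eq_trans Y X Z : fdd_eq P X Y -> fdd_eq P Y Z -> fdd_eq P X Z.
Proof. by move=> XY YZ k t B mB; rewrite XY // YZ. Qed.

Lemma fdd_eq_comp (f : 'cV[R]_m -> 'cV[R]_m) X Y : fdd_eq P X Y ->
  fdd_eq P (fun t => X (f t)) (fun t => Y (f t)).
Proof. by move=> XY k t B mB; exact: (XY k (f \o t) B mB). Qed.

Lemma law_eq_mull p q k (A : 'M[R]_(p, q)) (V W : T -> 'M[R]_(q, k)) :
  law_eq P V W -> law_eq P (fun w => A *m V w) (fun w => A *m W w).
Proof.
move=> VW B mB.
have mA : measurable_fun setT ((fun M => A *m M) : borel_mx R q k -> borel_mx R p k).
  exact: (@measurable_rmx_mull _ (borel_mx R q k) R p q k A id (@measurable_id _ _ _)).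
have mAB := mA measurableT _ mB; rewrite setTI in mAB.
exact: VW mAB.
Qed.

Lemma fdd_eq_mull A X Y : fdd_eq P X Y ->
  fdd_eq P (fun t w => A *m X t w) (fun t w => A *m Y t w).
Proof.
by move=> XY k t; rewrite !joint_mull; apply: law_eq_mull; exact: XY.
Qed.

(** The pairs of matrices through which a linear change of the index acts on [X]
    as a linear change of the values. *)
Definition similarity X C A := fdd_eq P (fun t => X (C *m t)) (fun t w => A *m X t w).

Lemma similarity1 X : similarity X 1%:M 1%:M.
Proof.
rewrite /similarity.
have -> : (fun t => X (1%:M *m t)) = X by apply/funext => t; rewrite mul1mx.
have -> : (fun t w => 1%:M *m X t w) = X by apply/funext => t; apply/funext => w; rewrite mul1mx.
by move=> k t B.
Qed.

Lemma similarityM X C A D B : similarity X C A -> similarity X D B ->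
  similarity X (C *m D) (A *m B).
Proof.
rewrite /similarity => XC XD; apply: (@fdd_eq_trans (fun t w => A *m X (D *m t) w)).
  have -> : (fun t => X (C *m D *m t)) = (fun t => X (C *m (D *m t))).
    by apply/funext => t; rewrite mulmxA.
  exact: (fdd_eq_comp (fun t => D *m t) XC).
have -> : (fun t w => A *m B *m X t w) = (fun t w => A *m (B *m X t w)).
  by apply/funext => t; apply/funext => w; rewrite mulmxA.
exact: fdd_eq_mull.
Qed.

Lemma similarityV X C A : C \in unitmx -> A \in unitmx -> similarity X C A ->
  similarity X (invmx C) (invmx A).
Proof.
move=> uC uA XC; apply: fdd_eq_sym.
have := fdd_eq_mull (invmx A) (fdd_eq_comp (fun t => invmx C *m t) XC).
have -> : (fun t w => invmx A *m X (C *m (invmx C *m t)) w) =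
    (fun t w => invmx A *m X t w).
  by apply/funext => t; rewrite mulKVmx.
have -> // : (fun t w => invmx A *m (A *m X (invmx C *m t) w)) =
    (fun t => X (invmx C *m t)).
by apply/funext => t; apply/funext => w; rewrite mulKmx.
Qed.

Lemma range_symmetries_similarity X B :
  range_symmetries P X B <-> similarity X 1%:M B.
Proof.
rewrite /range_symmetries /similarity /=.
have -> : (fun t => X (1%:M *m t)) = X by apply/funext => t; rewrite mul1mx.
by split; exact: fdd_eq_sym.
Qed.

Lemma cvg_prob_joint X (C_ : nat -> 'M[R]_m) C k (t : 'I_k -> 'cV[R]_m) :
  random_field X -> stochastically_continuous P X -> C_ @ \oo --> C ->
  cvg_prob P (fun j => joint (fun s => X (C_ j *m s)) t)
    (joint (fun s => X (C *m s)) t).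
Proof.
move=> mX cX CC e e0.
have Ct l : (fun j => C_ j *m t l) @ \oo --> C *m t l.
  by apply: cvg_mulmx => //; exact: cvg_cst.
pose bad j l := [set w | e <= `|X (C_ j *m t l) w - X (C *m t l) w|].
have mbad j l : measurable (bad j l).
  exact: measurable_norm_ge (measurable_rmxB (mX _) (mX _)).
have lim : (fun j => \sum_(l < k) P (bad j l))%E @ \oo --> 0%E.
  have := @cvg_nnesum _ \oo _ R _ (index_enum 'I_k) (fun l j => P (bad j l))
    (fun=> 0%E) xpredT.
  rewrite big1 //; apply=> l _; first exact: nearW.
  exact: cX (Ct l) _ e0.
apply: (squeeze_cvge _ (@cvg_cst _ 0%E _ _ _) lim).
apply: nearW => j; rewrite measure_ge0 /=.
apply: (@le_trans _ _ (P (\big[setU/set0]_(l < k) bad j l))); last first.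
  exact: measure_bigsetU_le.
apply: le_measure; rewrite ?inE.
- have mj (D : 'M[R]_m) : measurable_rmx (joint (fun s => X (D *m s)) t).
    by apply: measurable_joint => s; exact: mX.
  exact: measurable_norm_ge (measurable_rmxB (mj _) (mj _)).
- exact: bigsetU_measurable.
move=> w /= le; rewrite -bigcup_seq; apply: contrapT => nbad.
have := le; rewrite leNgt => /negP; apply.
apply: mx_norm_lt => // i l; rewrite !mxE.
have Xl : `|X (C_ j *m t l) w - X (C *m t l) w| < e.
  rewrite ltNge; apply/negP => bw; apply: nbad; exists l => //=.
  exact: mem_index_enum.
apply: le_lt_trans Xl.
by have := ler_entry_norm (X (C_ j *m t l) w - X (C *m t l) w) i 0; rewrite !mxE.
Qed.

(** The left side converges in probability by stochastic continuity, the right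
    side because the law of [X] is tight. *)
Lemma similarity_closed X (C_ : nat -> 'M[R]_m) C (A_ : nat -> 'M[R]_n) A :
  random_field X -> stochastically_continuous P X ->
  C_ @ \oo --> C -> A_ @ \oo --> A -> (forall j, similarity X (C_ j) (A_ j)) ->
  similarity X C A.
Proof.
move=> mX cX CC AA XCA k t.
have mC D : measurable_rmx (joint (fun s => X (D *m s)) t).
  by apply: measurable_joint => s; exact: mX.
have mt := measurable_joint t mX.
rewrite joint_mull.
apply: (law_eq_lim (fun j => mC (C_ j)) (mC C)
  (fun j => measurable_rmx_mull (A_ j) mt) (measurable_rmx_mull A mt)).
- exact: cvg_prob_joint.
- exact: cvg_prob_mull.
by move=> j; rewrite -joint_mull; exact: XCA.
Qed.

Lemma closed_mx_set1 p q (M : 'M[R]_(p, q)) : closed [set M].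
Proof. exact: accessible_closed_set1 (hausdorff_accessible (@norm_hausdorff R _)) M. Qed.

(** A nonzero row of [A] would confine [V] to a hyperplane. *)
Lemma full_mull_eq0 p (A : 'M[R]_(p, n)) (V : T -> 'cV[R]_n) :
  measurable_rmx V -> full P V -> law_eq P (fun w => A *m V w) (fun=> 0) -> A = 0.
Proof.
move=> mV fV AV; apply/eqP/negPn/negP => A0.
have [i Ai] : exists i, row i A != 0.
  apply/existsP; rewrite -[X in is_true X]negbK negb_exists; apply: contra A0.
  move=> /forallP Ai; apply/eqP/row_matrixP => i; rewrite row0.
  by apply/eqP; rewrite -[_ == _]negbK.
apply: (fV (row i A) 0 Ai).
have m0 : measurable ([set 0] : set (borel_mx R p 1)).
  by apply: measurable_closed_mx; exact: closed_mx_set1.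
have PAV : P [set w | A *m V w = 0] = 1%E.
  rewrite (AV _ m0) (_ : _ @^-1` _ = setT) ?probability_setT //.
  by apply/seteqP; split.
apply/eqP; rewrite eq_le probability_le1 /=; last first.
  have -> : [set w | row i A *m V w = 0%:M] =
    (fun w => row i A *m V w) @^-1` [set 0%:M] by [].
  apply: measurable_rmx_preimage (measurable_rmx_mull _ mV) _.
  by apply: measurable_closed_mx; exact: closed_mx_set1.
rewrite -PAV; apply: le_measure; rewrite ?inE.
- exact: measurable_rmx_preimage (measurable_rmx_mull A mV) m0.
- have -> : [set w | row i A *m V w = 0%:M] =
    (fun w => row i A *m V w) @^-1` [set 0%:M] by [].
  apply: measurable_rmx_preimage (measurable_rmx_mull _ mV) _.
  by apply: measurable_closed_mx; exact: closed_mx_set1.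
by move=> w /= Aw; rewrite -row_mul Aw row0 raddf0.
Qed.

(** The left kernel of [A] kills [A *m X t], hence also [X (C *m t)], which is
    full. *)
Lemma similarity_unit X C A (t : 'cV[R]_m) : random_field X -> Defs.proper P X -> C *m t != 0 ->
  t != 0 -> similarity X C A -> A \in unitmx.
Proof.
move=> mX pX Ct t0 XCA; rewrite -row_free_unit -kermx_eq0; apply/eqP.
apply: (full_mull_eq0 (mX (C *m t)) (pX _ Ct)).
have := law_eq_mull (kermx A) (fdd_eq_law t XCA).
have -> // : (fun w => kermx A *m (A *m X t w)) = fun=> 0.
by apply/funext => w; rewrite mulmxA mulmx_ker mul0mx.
Qed.

(** For symmetries of unbounded norm, a limit point [C] of [B / `|B|] has norm
    one, while [C *m X t] has the law of the limit of [X t / `|B|], that is,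
    zero. *)
Lemma range_symmetries_bounded X (t : 'cV[R]_m) : random_field X -> Defs.proper P X -> t != 0 ->
  exists b : R, forall B, range_symmetries P X B -> `|B| <= b.
Proof.
move=> mX pX t0; apply: contrapT => /forallNP nb.
have ex (j : nat) : exists B, range_symmetries P X B /\ j.+1%:R < `|B|.
  have := nb j.+1%:R => /existsNP[B /not_implyP[GB /negP]].
  by rewrite -ltNge; exists B.
have [B BP] := choice ex.
have B0 j : 0 < `|B j| by have [_] := BP j; apply: lt_trans.
pose u j := `|B j|^-1 *: B j.
have u1 j : `|u j| = 1.
  by rewrite normrZ normfV normr_id mulVf // gt_eqF.
have [f [C [fj uC]]] : exists (f : nat -> nat) (C : 'M[R]_n),
    (forall j, (j <= f j)%N) /\ (u \o f) @ \oo --> C.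
  by apply: (@bounded_mx_subseq _ _ _ _ 1) => j; rewrite u1.
have C1 : `|C| = 1.
  have nC : (fun j => `|(u \o f) j|) @ \oo --> `|C| by exact: cvg_norm uC.
  have n1 : (fun j => `|(u \o f) j|) @ \oo --> (1 : R).
    by apply: cvg_near_cst; apply: nearW => j /=; rewrite u1.
  exact: (cvg_unique (@Rhausdorff R) nC n1).
suff C0 : C = 0 by move: C1; rewrite C0 normr0 => /eqP; rewrite eq_sym oner_eq0.
apply: (full_mull_eq0 (mX t) (pX _ t0)).
pose v j : 'M[R]_n := (`|B (f j)|^-1)%:M.
have v0 : v @ \oo --> (0 : 'M[R]_n).
  apply: (@cvg_dist_bound _ _ _ _ (fun j => j.+1%:R^-1)); last exact: cvg_harmonic.
  move=> j; rewrite subr0 /v -scalemx1 normrZ normfV normr_id.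
  have [_ Bj] := BP (f j).
  apply: (@le_trans _ _ (`|B (f j)|^-1)).
    by rewrite ler_piMr ?scalar_mx_norm_le1 // invr_ge0.
  rewrite lef_pV2 ?posrE // (le_trans _ (ltW Bj)) // ler_nat ltnS.
  exact: fj.
have -> : (fun=> 0) = (fun w => (0 : 'M[R]_n) *m X t w).
  by apply/funext => w; rewrite mul0mx.
apply: (law_eq_lim (fun j => measurable_rmx_mull ((u \o f) j) (mX t))
  (measurable_rmx_mull C (mX t)) (fun j => measurable_rmx_mull (v j) (mX t))
  (measurable_rmx_mull 0 (mX t))).
- exact (@cvg_prob_mull _ _ _ P n n 1 (u \o f) C (X t) (mX t) uC).
- exact (@cvg_prob_mull _ _ _ P n n 1 v 0 (X t) (mX t) v0).
move=> j; rewrite /= /u /v.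
have [GB _] := BP (f j).
have := law_eq_mull (`|B (f j)|^-1)%:M (fdd_eq_law t GB).
have -> // : (fun w => `|B (f j)|^-1 %:M *m (B (f j) *m X t w)) =
   (fun w => `|B (f j)|^-1 *: B (f j) *m X t w).
by apply/funext => w; rewrite mulmxA mul_scalar_mx.
Qed.

End FiniteDimensionalLaws.

(** * Jordan-Chevalley decomposition over the reals *)

Definition squarefree_part (F : fieldType) (p : {poly F}) : {poly F} :=
  p %/ gcdp p p^`().

(** In characteristic zero a root of multiplicity [m] has multiplicity [m - 1] in
    the derivative, hence in the gcd. *)
Lemma root_squarefree_part (C : numClosedFieldType) (p : {poly C}) a :
  p != 0 -> root p a -> root (squarefree_part p) a.
Proof.
move=> p0 pa; set q := squarefree_part p; set g := gcdp p p^`().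
have pqg : p = q * g by rewrite divpK // dvdp_gcdl.
apply/negPn/negP => qa.
have [m [r]] := multiplicity_XsubC p a; rewrite p0 /= => ra pr.
have m0 : (0 < m)%N.
  rewrite lt0n; apply: contraL pa => /eqP m0; rewrite pr m0 expr0 mulr1.
  exact: ra.
have Xg : ('X - a%:P) ^+ m %| g.
  rewrite -(@Gauss_dvdpr _ _ q); first by rewrite -pqg pr dvdp_mulIr.
  by rewrite coprimep_expl // coprimep_sym coprimep_XsubC.
have : ('X - a%:P) ^+ m %| p^`() by exact: dvdp_trans Xg (dvdp_gcdr _ _).
case: m m0 pr {Xg} => // k _ pr.
rewrite pr derivM dvdp_addr ?dvdp_mulIr // deriv_exp derivXsubC mul1r /=.
rewrite mulrnAr [r * _]mulrC -mulrnAr exprSr dvdp_mul2l; last first.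
  by rewrite expf_neq0 // polyXsubC_eq0.
rewrite dvdp_XsubCl rootE hornerMn mulrn_eq0 /= => ra0.
by move: ra; rewrite rootE ra0.
Qed.

Lemma dvdp_squarefree_part_exp (C : numClosedFieldType) (p : {poly C}) :
  p != 0 -> exists N, p %| squarefree_part p ^+ N.
Proof.
move=> p0; have [r pr] := closed_field_poly_normal p.
exists (size r); rewrite pr dvdpZl ?lead_coef_eq0 // -pr.
have : all (root (squarefree_part p)) r.
  apply/allP => z zr; apply: root_squarefree_part => //.
  by rewrite pr rootZ ?lead_coef_eq0 // root_prod_XsubC.
elim: (r) => [|z s IH] /=; first by rewrite big_nil expr0 dvdpp.
case/andP => rz rs; rewrite big_cons exprS dvdp_mul ?IH //.
by rewrite dvdp_XsubCl.
Qed.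

Lemma comp_poly_taylor2 (F : fieldType) (q s h : {poly F}) :
  exists w, q \Po (s + h) = q \Po s + h * (q^`() \Po s) + h ^+ 2 * w.
Proof.
elim/poly_ind: q => [|q c [w IH]].
  by exists 0; rewrite deriv0 !comp_poly0 !mulr0 !addr0.
exists (w * (s + h) + (q^`() \Po s)).
rewrite derivD derivC addr0 derivM derivX mulr1 !comp_polyD !comp_polyM.
rewrite !comp_polyX !comp_polyC IH; ring.
Qed.

(** Newton iteration for a root of [q] in [F[X] / (q ^+ N)], starting at ['X]: the
    derivative of [q] is invertible there since [q] is separable, and each step
    doubles the precision. *)
Lemma newton_root (F : fieldType) (q : {poly F}) k : separable_poly q ->
  exists s, q ^+ (2 ^ k)%N %| q \Po s /\ q %| s - 'X.
Proof.
rewrite separable_poly.unlock => /Bezout_eq1_coprimepP[[u v] /= uv].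
elim: k => [|k [s [qs sX]]].
  by exists 'X; rewrite comp_polyXr subrr dvdp0 expn0 expr1 dvdpp.
have [w tay] := comp_poly_taylor2 q s (- (q \Po s) * (v \Po s)).
exists (s + - (q \Po s) * (v \Po s)); split.
  rewrite tay.
  have -> : q \Po s + - (q \Po s) * (v \Po s) * (q^`() \Po s) +
      (- (q \Po s) * (v \Po s)) ^+ 2 * w =
      (q \Po s) ^+ 2 * ((u \Po s) + (v \Po s) ^+ 2 * w).
    have := congr1 (fun p : {poly F} => p \Po s) uv.
    rewrite comp_polyD !comp_polyM comp_polyC polyC1.
    move: (q \Po s) (u \Po s) (v \Po s) (q^`() \Po s) => a b c e bac.
    apply: subr0_eq; rewrite (_ : _ - _ = a * (1 - (b * a + c * e))); last by ring.
    by rewrite bac subrr mulr0.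
  by rewrite dvdp_mulr // expnS mulnC exprM dvdp_exp2r.
rewrite addrAC dvdp_addr // !mulNr dvdpNr dvdp_mulr //.
apply: dvdp_trans qs.
by rewrite -[X in X %| _]expr1 dvdp_exp2l // expn_gt0.
Qed.

Section Jordan.
Context {R : realType} {n : nat}.
Notation mx := 'M[R]_n.+1.
Implicit Types (A B H M N S : mx) (p q : {poly R}).

Lemma horner_mx_comp A q s : horner_mx A (q \Po s) = horner_mx (horner_mx A s) q.
Proof.
elim/poly_ind: q => [|q c IH]; first by rewrite comp_poly0 !rmorph0.
rewrite comp_polyD comp_polyM comp_polyX comp_polyC !rmorphD !rmorphM /=.
by rewrite IH horner_mx_X !horner_mx_C.
Qed.

Lemma horner_mx_dvdp0 A p q : p %| q -> horner_mx A p = 0 -> horner_mx A q = 0.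
Proof. by move=> /dvdpP[r ->] pA; rewrite rmorphM /= pA mulr0. Qed.

Notation toC := (@complex_mx R n.+1).

Lemma diagonalizable_separable S q : separable_poly q -> horner_mx S q = 0 ->
  diagonalizable (toC S).
Proof.
move=> sq qS; apply/diagonalizableP.
have [r qr] := closed_field_poly_normal (map_poly (real_complex R) q).
have q0 : q != 0 by exact: separable_poly_neq0.
have l0 : lead_coef (map_poly (real_complex R) q) != 0.
  by rewrite lead_coef_eq0 map_poly_eq0.
exists r.
  have : separable_poly (map_poly (real_complex R) q) by rewrite separable_map.
  by rewrite qr (eqp_separable (eqp_scale _ l0)) separable_prod_XsubC.
apply: mxminpoly_min.
have : horner_mx (toC S) (map_poly (real_complex R) q) = 0.
  by rewrite /complex_mx -map_horner_mx qS map_mx0.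
rewrite qr linearZ /= => /eqP; rewrite scaler_eq0 (negPf l0) /=.
by move=> /eqP.
Qed.

(** The squarefree part [q] of the characteristic polynomial is separable, and
    [q.[H]] is nilpotent. Newton iteration corrects [H] to a root of [q] that is
    a polynomial in [H]; working with the gcd rather than with eigenvalues keeps
    everything over the reals. *)
Lemma jordan_decomposition H : exists s : {poly R},
  diagonalizable (toC (horner_mx H s)) /\ exists i, (H - horner_mx H s) ^+ i = 0.
Proof.
pose p := char_poly H; pose q := squarefree_part p.
have p0 : p != 0 by rewrite monic_neq0 // char_poly_monic.
have sq : separable_poly q by exact: make_separable.
have [k pq] : exists k, p %| q ^+ k.
  pose f := map_poly (real_complex R).
  have fp0 : f p != 0 by rewrite map_poly_eq0.
  have [k] := dvdp_squarefree_part_exp fp0; exists k.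
  rewrite -(dvdp_map (real_complex R)) rmorphXn /=.
  by rewrite /q /squarefree_part map_divp gcdp_map -deriv_map.
have [s [qs sX]] := newton_root k sq.
have qN : horner_mx H (q ^+ k) = 0.
  exact: horner_mx_dvdp0 pq (Cayley_Hamilton H).
exists s; split.
  apply: (diagonalizable_separable sq); rewrite -horner_mx_comp.
  apply: horner_mx_dvdp0 qs (horner_mx_dvdp0 _ qN).
  by rewrite dvdp_exp2l // ltnW // ltn_expl.
exists k; have /dvdpP[r sXr] := sX.
have -> : H - horner_mx H s = horner_mx H (- r * q).
  by rewrite mulNr -sXr opprB rmorphB /= horner_mx_X.
by rewrite -rmorphXn exprMn rmorphM /= qN mulr0.
Qed.

End Jordan.

Section Diagonalizable.
Context {F : fieldType} {n : nat}.
Implicit Types A B : 'M[F]_n.+1.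

Lemma diagonalizable_comm A B : diagonalizable A -> diagonalizable B ->
  A * B = B * A -> diagonalizable (A + B) /\ diagonalizable (A - B).
Proof.
move=> dA dB AB.
have [P uP /and3P[/= dPA dPB _]] : codiagonalizable [:: A; B].
  apply/codiagonalizableP; split=> [f g|f].
    by rewrite !inE => /orP[]/eqP-> /orP[]/eqP->.
  by rewrite !inE => /orP[]/eqP->.
have /is_diag_mxP DA := dPA; have /is_diag_mxP DB := dPB.
rewrite !conjumx // in DA DB.
split; exists P => //; apply/similar_diagPp => i j ij.
  by rewrite conjumx // mulmxDr mulmxDl mxE DA // DB // addr0.
by rewrite conjumx // mulmxBr mulmxBl mxE DA // mxE DB // subrr.
Qed.

(** The minimal polynomial divides a power of ['X] and is squarefree. *)
Lemma diagonalizable_nilpotent A k : diagonalizable A -> A ^+ k = 0 -> A = 0.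
Proof.
move=> /diagonalizableP[rs urs prs] Ak.
have pX : mxminpoly A %| 'X^k.
  by apply: mxminpoly_min; rewrite rmorphXn /= horner_mx_X.
have sA : separable_poly (mxminpoly A).
  by apply: dvdp_separable prs _; rewrite separable_prod_XsubC.
rewrite -['X]subr0 -polyC0 in pX; have [j _ pj] := dvdp_exp_XsubCP pX.
have j1 : (j <= 1)%N.
  rewrite leqNgt; apply/negP => j2.
  have /separable_polyP[sep _] := sA.
  have : coprimep ('X - 0%:P : {poly F}) ('X - 0%:P).
    by apply: sep; rewrite (eqp_dvdr _ pj) -expr2 dvdp_exp2l.
  by rewrite coprimep_XsubC root_XsubC eqxx.
have : mxminpoly A %| 'X - 0%:P.
  by rewrite (eqp_dvdl _ pj) -[X in _ %| X]expr1 dvdp_exp2l.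
rewrite polyC0 subr0 => /mxminpoly_minP.
by rewrite horner_mx_X.
Qed.

End Diagonalizable.

Lemma nilpotent_sub_comm (A : pzRingType) (x y : A) i j : GRing.comm x y ->
  x ^+ i = 0 -> y ^+ j = 0 -> exists k, (x - y) ^+ k = 0.
Proof.
move=> xy xi yj; exists (i + j)%N.
rewrite exprBn_comm // big1 // => k _.
have [ik|ki] := leqP i (i + j - k).
  by rewrite -(subnK ik) exprD xi mulr0 mulr0 mul0r mul0rn.
have jk : (j <= k)%N.
  by lia.
by rewrite -(subnK jk) [y ^+ _]exprD yj !mulr0 mul0rn.
Qed.

Section NilpotentPart.
Context {R : realType} {n : nat}.
Notation mx := 'M[R]_n.+1.
Implicit Types (A B H M N S : mx) (p q : {poly R}).
Notation toC := (@complex_mx R n.+1).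

Lemma complex_mxM A B : toC (A * B) = toC A * toC B.
Proof. exact: map_mxM. Qed.
Lemma complex_mxD A B : toC (A + B) = toC A + toC B.
Proof. exact: map_mxD. Qed.
Lemma complex_mxB A B : toC (A - B) = toC A - toC B.
Proof. exact: map_mxB. Qed.
Lemma complex_mx_inj : injective toC.
Proof. exact: map_mx_inj. Qed.

Lemma diagonalizable_complex_nilpotent A k : diagonalizable (toC A) -> A ^+ k = 0 -> A = 0.
Proof.
move=> dA Ak; apply: complex_mx_inj; rewrite [RHS]map_mx0.
apply: (diagonalizable_nilpotent dA (k := k)).
by rewrite /complex_mx -rmorphXn /= Ak map_mx0.
Qed.

(** Two decompositions of [H] commute, one of them being polynomial in [H]; the
    difference of the semisimple parts is then diagonalizable, and it is
    nilpotent as a difference of commuting nilpotents. *)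
Lemma nilpotent_part_unique H s : diagonalizable (toC (horner_mx H s)) ->
  (exists i, (H - horner_mx H s) ^+ i = 0) ->
  forall N, is_nilpotent_part H N <-> N = H - horner_mx H s.
Proof.
set S := horner_mx H s => dS [i Ni] N; split=> [[S' [HSN dS' [j Nj] SN]]|->]; last first.
  exists S; split => //; [by rewrite addrC subrK|by exists i|].
  rewrite mulmxBr mulmxBl; congr (_ - _); exact: comm_horner_mx.
have S'H : S' * H = H * S' by rewrite HSN mulrDr mulrDl; congr (_ + _).
have NH : N * H = H * N by rewrite HSN mulrDr mulrDl; congr (_ + _).
have S'S : S * S' = S' * S by exact/esym/comm_mx_horner.
have NS : N * S = S * N by exact: comm_mx_horner.
have SS' : S - S' = N - (H - S).
  have -> : N = H - S' by rewrite HSN [S' + N]addrC addrK.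
  by rewrite opprB [RHS]addrC addrA subrK.
have dd : diagonalizable (toC (S - S')).
  rewrite complex_mxB; apply: (diagonalizable_comm dS dS' _).2.
  by rewrite -!complex_mxM S'S.
have [k Nk] : exists k, (N - (H - S)) ^+ k = 0.
  apply: nilpotent_sub_comm Nj Ni.
  by rewrite /GRing.comm mulrBr mulrBl NH NS.
have := diagonalizable_complex_nilpotent dd (k := k); rewrite SS' => /(_ Nk) /eqP.
by rewrite subr_eq0 => /eqP.
Qed.

End NilpotentPart.

(** * Matrices that are skew for a positive definite form *)

Section Skew.
Context {R : realType} {n : nat}.
Notation mx := 'M[R]_n.+1.
Implicit Types (A B H M N S Q Y Z : mx) (p q : {poly R}).
Notation toC := (@complex_mx R n.+1).

Definition positive_form Q :=
  Q^T = Q /\ forall x : 'rV[R]_n.+1, x != 0 -> 0 < (x *m Q *m x^T) 0 0.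

(** Infinitesimal form of [B *m Q *m B^T = Q]: [- A] is the adjoint of [A] for the
    form [Q] on row vectors. *)
Definition skew_for Q A := A *m Q = - (Q *m A^T).

Lemma positive_form_eq0 Q Y : positive_form Q -> Y *m Q *m Y^T = 0 -> Y = 0.
Proof.
move=> [_ posQ] YQ; apply/row_matrixP => i; rewrite row0; apply/eqP/negPn/negP => Yi.
have := posQ _ Yi.
suff -> : (row i Y *m Q *m (row i Y)^T) 0 0 = (Y *m Q *m Y^T) i i.
  by rewrite YQ mxE ltxx.
rewrite tr_row -row_mul [LHS]mxE [RHS]mxE; apply: eq_bigr => j _.
by rewrite [row _ _ _ _]mxE [col _ _ _ _]mxE.
Qed.

(** If [Z] is self-adjoint then [x Z] has [Q]-square [x Z^2 Q x^T], so [Z ^+ 2 = 0]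
    forces [Z = 0]; repeated halving of the exponent reaches [Z] itself. *)
Lemma selfadjoint_nilpotent Q Z k : positive_form Q -> Z *m Q = Q *m Z^T ->
  Z ^+ k = 0 -> Z = 0.
Proof.
move=> pQ ZQ Zk.
have ZXQ j : Z ^+ j *m Q = Q *m (Z ^+ j)^T.
  elim: j => [|j IH]; first by rewrite !expr0 trmx1 mul1mx mulmx1.
  by rewrite {1}exprSr -mulmxA ZQ mulmxA IH -mulmxA exprS trmx_mul.
have {Zk} : Z ^+ (2 ^ k) = 0.
  by rewrite -(subnK (ltnW (ltn_expl k (ltnSn 1)))) exprD Zk mulr0.
elim: k => [|k IH]; first by rewrite expn0 expr1.
move=> Z2k; apply: IH; apply: (positive_form_eq0 pQ).
rewrite -mulmxA -[Q *m _]ZXQ mulmxA.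
have -> : Z ^+ (2 ^ k) *m Z ^+ (2 ^ k) = Z ^+ (2 ^ k.+1).
  by rewrite mulmxE -exprD addnn -mul2n expnS.
by rewrite Z2k mul0mx.
Qed.

(** A polynomial [Y] in a skew matrix is normal: its adjoint [W] is the same
    polynomial at [- A]. So [Y *m W] is self-adjoint and nilpotent, hence zero,
    and it vanishes only if [Y] does. *)
Lemma skew_nilpotent Q A p k : positive_form Q -> skew_for Q A ->
  horner_mx A p ^+ k = 0 -> horner_mx A p = 0.
Proof.
move=> pQ sA; set Y := horner_mx A p => Yk; pose W := horner_mx (- A) p.
have [symQ _] := pQ.
have YQ : Y *m Q = Q *m W^T.
  rewrite /Y /W; elim/poly_ind: (p) => [|q c IH].
    by rewrite !rmorph0 trmx0 mul0mx mulmx0.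
  rewrite !rmorphD !rmorphM /= !horner_mx_X !horner_mx_C.
  rewrite mulmxDl linearD /= mulmxDr tr_scalar_mx scalar_mxC; congr (_ + _).
  rewrite trmx_mul -mulmxA sA mulmxN mulmxA IH linearN /= mulNmx mulmxN.
  rewrite -!mulmxA; congr (- (Q *m _)).
  rewrite -!trmx_mul; congr trmx.
  by apply: comm_mx_horner; rewrite /comm_mx mulNmx mulmxN.
have WQ : W *m Q = Q *m Y^T.
  by apply: trmx_inj; rewrite !trmx_mul symQ trmxK YQ.
have YW : Y * W = W * Y.
  apply/esym/comm_mx_horner; rewrite /W; apply: comm_horner_mx.
  by rewrite /comm_mx mulNmx mulmxN.
have Z0 : Y *m W = 0.
  apply: (selfadjoint_nilpotent (Q := Q) (k := k) pQ).
    by rewrite -mulmxA WQ mulmxA YQ -mulmxA -trmx_mul mulmxE YW.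
  by rewrite mulmxE exprMn_comm // Yk mul0r.
by apply: (positive_form_eq0 pQ); rewrite -mulmxA -WQ mulmxA Z0 mul0mx.
Qed.

(** The nilpotent part of [A] is a polynomial in [A]. *)
Lemma skew_diagonalizable Q A : positive_form Q -> skew_for Q A -> diagonalizable (toC A).
Proof.
move=> pQ sA; have [s [dS [k Nk]]] := jordan_decomposition A.
suff -> : A = horner_mx A s by [].
apply/eqP; rewrite -subr_eq0; apply/eqP.
have E : A - horner_mx A s = horner_mx A ('X - s).
  by rewrite rmorphB /= horner_mx_X.
by move: Nk; rewrite E; exact: skew_nilpotent pQ sA.
Qed.

Lemma quad_skew0 Q A (x : 'rV[R]_n.+1) : positive_form Q -> skew_for Q A ->
  (x *m A *m Q *m x^T) 0 0 = 0.
Proof.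
move=> [symQ _] sA.
suff e : x *m A *m Q *m x^T = - (x *m A *m Q *m x^T).
  have := congr1 (fun M : 'M[R]_1 => M 0 0) e; rewrite [RHS]mxE => /eqP.
  by rewrite -addr_eq0 -mulr2n mulrn_eq0 /= => /eqP.
have MT : (x *m A *m Q *m x^T)^T = x *m A *m Q *m x^T.
  by rewrite [x *m A *m Q *m x^T]mx11_scalar tr_scalar_mx.
rewrite -{1}MT !trmx_mul trmxK symQ -(mulmxA x A Q) sA mulmxN mulNmx opprK.
by rewrite !mulmxA.
Qed.

(** For an eigenvector [x + i y], the quadratic form [Q] vanishes on the pairs
    [(x A, x)] and [(y A, y)]; adding the two identities leaves
    [Re z (Q(x, x) + Q(y, y)) = 0]. *)
Lemma skew_eigenvalue Q A (z : R[i]) : positive_form Q -> skew_for Q A ->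
  eigenvalue (toC A) z -> complex.Re z = 0.
Proof.
move=> pQ sA /eigenvalueP[v vA v0].
pose x := map_mx (@complex.Re R) v; pose y := map_mx (@complex.Im R) v.
have [symQ posQ] := pQ.
have xA : x *m A = complex.Re z *: x - complex.Im z *: y.
  apply/rowP => j; have := congr1 (fun w : 'rV[R[i]]_n.+1 => complex.Re (w 0 j)) vA.
  rewrite !mxE raddf_sum /= => e.
  rewrite (eq_bigr (fun k => complex.Re (v 0 k * toC A k j))).
    by rewrite e; case: (z) (v 0 j) => [a b] [c e'].
  by move=> k _; rewrite !mxE; case: (v 0 k) => a b /=; rewrite mulr0 subr0.
have yA : y *m A = complex.Re z *: y + complex.Im z *: x.
  apply/rowP => j; have := congr1 (fun w : 'rV[R[i]]_n.+1 => complex.Im (w 0 j)) vA.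
  rewrite !mxE raddf_sum /= => e.
  rewrite (eq_bigr (fun k => complex.Im (v 0 k * toC A k j))).
    by rewrite e; case: (z) (v 0 j) => [a b] [c e'].
  by move=> k _; rewrite !mxE; case: (v 0 k) => a b /=; rewrite mulr0 add0r.
pose f (a b : 'rV[R]_n.+1) := (a *m Q *m b^T) 0 0.
have fC a b : f a b = f b a.
  rewrite /f; have <- : (b *m Q *m a^T)^T = a *m Q *m b^T.
    by rewrite !trmx_mul trmxK symQ mulmxA.
  by rewrite mxE.
have hx := quad_skew0 x pQ sA; have hy := quad_skew0 y pQ sA.
have lin (c c' : R) (M N : 'M[R]_1) : (c *: M + c' *: N) 0 0 = c * M 0 0 + c' * N 0 0.
  by rewrite !mxE.
have ex : complex.Re z * f x x - complex.Im z * f y x = 0.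
  move: hx; rewrite xA -scaleNr 2!mulmxDl -!scalemxAl.
  by move=> <-; rewrite -mulNr; exact/esym/lin.
have ey : complex.Re z * f y y + complex.Im z * f x y = 0.
  move: hy; rewrite yA 2!mulmxDl -!scalemxAl.
  by move=> <-; exact/esym/lin.
have pos (a : 'rV[R]_n.+1) : 0 <= f a a /\ (f a a = 0 -> a = 0).
  have [->|a0] := eqVneq a 0; first by rewrite /f !mul0mx mxE; split.
  have := posQ a a0; rewrite -/(f a a) => fa; split; first exact: ltW.
  by move=> fa0; rewrite fa0 ltxx in fa.
have : complex.Re z * (f x x + f y y) = 0.
  by rewrite mulrDr -[RHS]addr0 -{1}ex -ey fC; ring.
move=> /eqP; rewrite mulf_eq0 => /orP[/eqP//|].
rewrite paddr_eq0; [|exact: (pos x).1|exact: (pos y).1].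
move=> /andP[/eqP /(pos x).2 x0 /eqP /(pos y).2 y0].
case/negP: v0; apply/eqP/rowP => j; rewrite mxE.
have := congr1 (fun w : 'rV[R]_n.+1 => w 0 j) x0.
have := congr1 (fun w : 'rV[R]_n.+1 => w 0 j) y0.
by rewrite !mxE; case: (v 0 j) => a b /= -> ->.
Qed.

(** An eigenspace of [H + A] is stable under [A], so it contains an eigenvector of
    [A]; this vector is an eigenvector of [H], for an eigenvalue with the same
    real part. *)
Lemma real_spectrum_add_skew Q H A : positive_form Q -> skew_for Q A ->
  H *m A = A *m H -> real_spectrum (H + A) `<=` real_spectrum H.
Proof.
move=> pQ sA HA a [z Hz <-] /=.
have comm : comm_mx (toC (H + A)) (toC A).
  by rewrite /comm_mx /complex_mx -!map_mxM mulmxDl mulmxDr HA.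
pose V := eigenspace (toC (H + A)) z.
have V0 : (0 < \rank V)%N by rewrite lt0n mxrank_eq0.
have [w Aw] := eigenvalue_closed (restrictmx V (toC A)) V0.
have stV : stablemx V (toC A) by rewrite comm_mx_stable_eigenspace.
have /eigenvalueP[u uA u0] := Aw.
pose v := u *m row_base V.
have v0 : v != 0 by rewrite mulmx_free_eq0 // row_base_free.
have vA : v *m toC A = w *: v.
  have stb : stablemx (row_base V) (toC A) by rewrite stablemx_row_base.
  have rb : row_base V *m toC A = restrictmx V (toC A) *m row_base V.
    by rewrite /conjmx mulmxKpV.
  by rewrite /v -mulmxA rb mulmxA uA scalemxAl.
have vH : v *m toC (H + A) = z *: v.
  by apply/eigenspaceP; rewrite /v mulmx_sub // eq_row_base.
exists (z - w); last first.
  have : eigenvalue (toC A) w by apply/eigenvalueP; exists v.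
  move=> /(skew_eigenvalue pQ sA) w0.
  by case: (z) (w) w0 => [zr zi] [wr wi] /= ->; rewrite subr0.
apply/eigenvalueP; exists v => //.
have -> : toC H = toC (H + A) - toC A by rewrite complex_mxD addrK.
by rewrite mulmxBr vH vA scalerBl.
Qed.

End Skew.

(** * Fixed points of bounded groups of linear maps *)

Section FixedPoint.
Context {R : realType} {n : nat}.
Notation mx := 'M[R]_n.
Implicit Types (M N : mx).

Definition sqnorm M : R := \sum_i \sum_j M i j ^+ 2.

Lemma sqnorm_ge0 M : 0 <= sqnorm M.
Proof. by apply: sumr_ge0 => i _; apply: sumr_ge0 => j _; exact: sqr_ge0. Qed.

Lemma sqnorm_le M : sqnorm M <= n%:R * n%:R * `|M| ^+ 2.
Proof.
apply: (@le_trans _ _ (\sum_(i < n) \sum_(j < n) `|M| ^+ 2)).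
  apply: ler_sum => i _; apply: ler_sum => j _.
  by rewrite -real_normK ?num_real // lerXn2r ?nnegrE // ler_entry_norm.
by rewrite !sumr_const !card_ord -mulrA !mulr_natl.
Qed.

Lemma norm_le_sqnorm M : `|M| ^+ 2 <= sqnorm M.
Proof.
rewrite -(sqr_sqrtr (sqnorm_ge0 M)) lerXn2r ?nnegrE ?sqrtr_ge0 //.
apply: mx_norm_le => [|i j]; first exact: sqrtr_ge0.
rewrite -sqrtr_sqr ler_wsqrtr // /sqnorm (bigD1 i) //= (bigD1 j) //= -addrA.
rewrite lerDl addr_ge0 ?sumr_ge0 // => [k _|k _]; first exact: sqr_ge0.
by rewrite sumr_ge0 // => l _; exact: sqr_ge0.
Qed.

Lemma sqnorm_midpoint M N :
  sqnorm (2^-1 *: (M + N)) = 2^-1 * (sqnorm M + sqnorm N) - 4^-1 * sqnorm (M - N).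
Proof.
rewrite /sqnorm -big_split /= 2!mulr_sumr -sumrB; apply: eq_bigr => i _.
rewrite -big_split /= 2!mulr_sumr -sumrB; apply: eq_bigr => j _.
by rewrite !mxE; field.
Qed.

Lemma cvg_sqnorm (u : nat -> mx) M : u @ \oo --> M ->
  (fun j => sqnorm (u j)) @ \oo --> sqnorm M.
Proof.
move=> /cvg_mxP uM; apply: cvg_big => [|i _]; first exact: add_continuous.
apply: cvg_big => [|j _]; first exact: add_continuous.
rewrite expr2; under eq_fun do rewrite expr2.
by apply: cvgM; exact: uM.
Qed.

Variables (G : set (mx -> mx)) (b : R) (K : set mx).
Hypothesis G_linear : forall g, G g -> forall (a : R) M N, g (a *: M + N) = a *: g M + g N.
Hypothesis G_id : G id.
Hypothesis G_comp : forall g h, G g -> G h -> G (g \o h).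
Hypothesis G_inv : forall g, G g -> exists2 h, G h & cancel g h.
Hypothesis G_bounded : forall g, G g -> forall M, `|g M| <= b * `|M|.
Hypothesis K_nonempty : K !=set0.
Hypothesis K_closed : forall (u : nat -> mx) M, (forall j, K (u j)) -> u @ \oo --> M -> K M.
Hypothesis K_midpoint : forall M N, K M -> K N -> K (2^-1 *: (M + N)).
Hypothesis K_stable : forall g M, G g -> K M -> K (g M).

Let GB g : G g -> forall M N, g (M - N) = g M - g N.
Proof.
by move=> Gg M N; have := G_linear Gg (-1) N M; rewrite !scaleN1r addrC [RHS]addrC.
Qed.

Let GZ g : G g -> forall (a : R) M, g (a *: M) = a *: g M.
Proof.
move=> Gg a M; have := G_linear Gg a M 0; rewrite addr0 => ->.
by have := GB Gg 0 0; rewrite !subrr => ->; rewrite addr0.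
Qed.

Let GD g : G g -> forall M N, g (M + N) = g M + g N.
Proof. by move=> Gg M N; have := G_linear Gg 1 M N; rewrite !scale1r. Qed.

(** The squared orbit norm: an invariant function that inherits strict convexity
    from the Euclidean norm. *)
Definition orbit_sup M : R := sup [set sqnorm (g M) | g in G].

Let has_sup_orbit M : has_sup [set sqnorm (g M) | g in G].
Proof.
split; first by exists (sqnorm M); exists id.
exists (n%:R * n%:R * (b * `|M|) ^+ 2) => _ [g Gg <-].
rewrite (le_trans (sqnorm_le _)) // ler_wpM2l ?mulr_ge0 //.
rewrite lerXn2r ?nnegrE //; first by rewrite (le_trans _ (G_bounded Gg M)).
exact: G_bounded.
Qed.

Let orbit_sup_ub g M : G g -> sqnorm (g M) <= orbit_sup M.
Proof.
by move=> Gg; apply: sup_upper_bound (has_sup_orbit M) _ _; exists g.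
Qed.

Let orbit_sup_le M c : (forall g, G g -> sqnorm (g M) <= c) -> orbit_sup M <= c.
Proof.
move=> le; apply: ge_sup; first exact: (has_sup_orbit M).1.
by move=> _ [g Gg <-]; exact: le.
Qed.

Let orbit_sup_ge0 M : 0 <= orbit_sup M.
Proof. exact: le_trans (sqnorm_ge0 M) (orbit_sup_ub M G_id). Qed.

(** The orbit norm attains its minimum on [K], and a minimiser [M] is moved by [g]
    to another one; if they differed, the parallelogram identity would make the
    norm at their midpoint smaller, uniformly over the orbit because the group is
    bounded. *)
Lemma common_fixed_point : exists2 M, K M & forall g, G g -> g M = M.
Proof.
pose I := inf [set orbit_sup M | M in K].
have hI : has_inf [set orbit_sup M | M in K].
  have [M KM] := K_nonempty.
  by split; [exists (orbit_sup M); exists M|exists 0 => _ [N _ <-]; exact: orbit_sup_ge0].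
have Ile M : K M -> I <= orbit_sup M.
  by move=> KM; apply: ge_inf hI.2 _ _; exists M.
have ex (j : nat) : exists M, K M /\ orbit_sup M < I + j.+1%:R^-1.
  have [|_ [M KM <-] lt] := @inf_adherent _ _ j.+1%:R^-1 _ hI.
    by rewrite invr_gt0.
  by exists M.
have [u uP] := choice ex.
have [f [M [fj uM]]] : exists (f : nat -> nat) (M : mx),
    (forall j, (j <= f j)%N) /\ (u \o f) @ \oo --> M.
  apply: (@bounded_mx_subseq _ _ _ _ (1 + (I + 1))) => j.
  have [_ lt] := uP j.
  have h1 : `|u j| ^+ 2 <= I + 1.
    rewrite (le_trans (norm_le_sqnorm _)) // (le_trans (orbit_sup_ub _ G_id)) //.
    by rewrite (le_trans (ltW lt)) // lerD2l invf_le1 // ler1n.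
  by have := sqr_ge0 (`|u j| - 1); nra.
have KM : K M by apply: K_closed uM => j; exact: (uP (f j)).1.
exists M => // g Gg.
have ccont h : G h -> (fun j => h (u (f j))) @ \oo --> h M.
  move=> Gh; apply: (@cvg_dist_bound _ _ _ _ (fun j => b * `|u (f j) - M|)).
    by move=> j; rewrite -GB //; exact: G_bounded.
  have dM : (fun j => u (f j) - M) @ \oo --> M - M.
    by apply: cvgB => //; exact: cvg_cst.
  have -> : (0 : R) = b * `|M - M| by rewrite subrr normr0 mulr0.
  by apply: cvgM; [exact: cvg_cst|exact: cvg_norm dM].
have fM : orbit_sup M <= I.
  apply: orbit_sup_le => h Gh.
  have c1 := cvg_sqnorm (ccont h Gh).
  have c2 : (fun j => I + j.+1%:R^-1) @ \oo --> (I : R).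
    by rewrite -[X in _ --> X]addr0; apply: cvgD; [exact: cvg_cst|exact: cvg_harmonic].
  apply: ler_cvg_to c1 c2 _; apply: nearW => j.
  have [_ lt] := uP (f j).
  rewrite (le_trans (orbit_sup_ub _ Gh)) // (le_trans (ltW lt)) // lerD2l.
  by rewrite lef_pV2 ?posrE // ler_nat ltnS.
pose N := g M.
have fN : orbit_sup N <= I.
  apply: le_trans fM; apply: orbit_sup_le => h Gh.
  exact: (orbit_sup_ub M (G_comp Gh Gg)).
have KN : K N by exact: K_stable.
(* The bound for the identity map forces [1 <= b] unless [M = N]. *)
have b0 : 0 < b \/ M - N = 0.
  have [->|D0] := eqVneq (M - N) 0; [by right|left].
  have := G_bounded G_id (M - N); rewrite /= => h.
  have nD : 0 < `|M - N| by rewrite normr_gt0.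
  by move: h; rewrite -[X in X <= _]mul1r ler_pM2r // => /lt_le_trans; apply.
case: b0 => [b0|/eqP]; last by rewrite subr_eq0 => /eqP.
have fP : orbit_sup (2^-1 *: (M + N)) <= I - 4^-1 * (`|M - N| / b) ^+ 2.
  apply: orbit_sup_le => h Gh.
  rewrite GZ // GD // sqnorm_midpoint lerB //.
    have := orbit_sup_ub M Gh; have := orbit_sup_ub N Gh.
    by move: fM fN; lra.
  rewrite ler_wpM2l // (le_trans _ (norm_le_sqnorm _)) //.
  rewrite lerXn2r ?nnegrE // ?divr_ge0 ?(ltW b0) // ler_pdivrMr // mulrC -GB //.
  have [h' Gh' hh'] := G_inv Gh.
  by rewrite -{1}[M - N]hh' G_bounded.
have := le_trans (Ile _ (K_midpoint KM KN)) fP.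
rewrite -subr_ge0 addrAC subrr add0r oppr_ge0 pmulr_rle0 ?invr_gt0 //.
move=> le0; have : (`|M - N| / b) ^+ 2 == 0 by rewrite eq_le le0 sqr_ge0.
rewrite sqrf_eq0 mulf_eq0 invr_eq0 (gt_eqF b0) orbF normr_eq0 subr_eq0.
by move=> /eqP.
Qed.

End FixedPoint.

(** * Structure of the range exponents *)

Lemma norm_row_le (R : realType) k (y : 'rV[R]_k) : `|y| ^+ 2 <= (y *m y^T) 0 0.
Proof.
have -> : (y *m y^T) 0 0 = \sum_j y 0 j ^+ 2.
  by rewrite mxE; apply: eq_bigr => j _; rewrite mxE.
have s0 : 0 <= \sum_j y 0 j ^+ 2 by apply: sumr_ge0 => j _; exact: sqr_ge0.
rewrite -(sqr_sqrtr s0) lerXn2r ?nnegrE ?sqrtr_ge0 //.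
apply: mx_norm_le => [|i j]; first exact: sqrtr_ge0.
rewrite ord1 -sqrtr_sqr ler_wsqrtr // (bigD1 j) //= lerDl sumr_ge0 // => l _.
exact: sqr_ge0.
Qed.

Lemma skew_forN (R : realType) n (Q A : 'M[R]_n.+1) : skew_for Q A -> skew_for Q (- A).
Proof.
rewrite /skew_for => sA.
have -> : (- A)^T = - A^T by apply/matrixP => i j; rewrite !mxE.
by rewrite mulNmx sA mulmxN.
Qed.

Section RangeExponents.
Context {d : measure_display} {T : measurableType d} {R : realType}.
Variables (P : probability T R) (m n : nat).
Variables (X : 'cV[R]_m.+1 -> T -> 'cV[R]_n.+1) (E : 'M[R]_m.+1).
Hypotheses (mX : random_field X) (pX : Defs.proper P X).
Hypothesis cX : stochastically_continuous P X.
Notation mx := 'M[R]_n.+1.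
Implicit Types (A B C H Q : mx).

Let G : set mx := range_symmetries P X.
Let EX : set mx := range_exponents P X E.
Let t1 : 'cV[R]_m.+1 := const_mx 1.

Let t1_neq0 : t1 != 0.
Proof. by apply/eqP => /colP/(_ 0); rewrite !mxE => /eqP; rewrite oner_eq0. Qed.

Lemma range_sym1 : G 1.
Proof. by apply/range_symmetries_similarity; exact: similarity1. Qed.

Lemma range_symM B C : G B -> G C -> G (B * C).
Proof.
move=> /range_symmetries_similarity GB /range_symmetries_similarity GC.
apply/range_symmetries_similarity.
by have := similarityM GB GC; rewrite mul1mx.
Qed.

Lemma range_sym_unit B : G B -> B \in unitmx.
Proof.
move=> /range_symmetries_similarity GB.
by apply: similarity_unit mX pX _ t1_neq0 GB; rewrite mul1mx.
Qed.

Lemma range_symV B : G B -> G (invmx B).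
Proof.
move=> GB; have uB := range_sym_unit GB; move: GB => /range_symmetries_similarity GB.
apply/range_symmetries_similarity.
by have := similarityV (unitmx1 _ _) uB GB; rewrite invmx1.
Qed.

Lemma range_sym_bounded : exists b : R, 1 <= b /\ forall B, G B -> `|B| <= b.
Proof.
have [b bP] := range_symmetries_bounded mX pX t1_neq0.
exists (`|b| + 1); split; first by rewrite lerDr.
by move=> B /bP le; rewrite (le_trans le) // (le_trans (ler_norm b)) // lerDl.
Qed.

Lemma mxexp_unit k (s : R) (M : 'M[R]_k.+1) : mxexp (s *: M) \in unitmx.
Proof. by have /mulmx1_unit[] := mxexpN s M. Qed.

Lemma invmx_mxexp k (s : R) (M : 'M[R]_k.+1) :
  invmx (mxexp (s *: M)) = mxexp (- s *: M).
Proof.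
by rewrite -[RHS]mulmx1 -(mulmxV (mxexp_unit s M)) mulmxA mulmxE mxexpN mul1r.
Qed.

Lemma range_exponentP H :
  EX H <-> forall s : R, similarity P X (mxexp (s *: E)) (mxexp (s *: H)).
Proof.
split=> [EH s|EH c c0]; first by have := EH _ (expR_gt0 s); rewrite /mxpow expRK.
exact: EH.
Qed.

Lemma similarityX (D : 'M[R]_m.+1) A k :
  similarity P X D A -> similarity P X (D ^+ k) (A ^+ k).
Proof.
move=> CA; elim: k => [|k IH]; first exact: similarity1.
by rewrite !exprS; exact: similarityM.
Qed.

(** [exp (- s H) exp (s H')] is a symmetry, with derivative [H' - H] at zero. *)
Lemma exponents_sub H H' : EX H -> EX H' -> tangent_space G (H' - H).
Proof.
move=> /range_exponentP EH /range_exponentP EH'.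
pose e j : R := j.+1%:R^-1.
have e0 j : e j != 0 by rewrite invr_eq0 pnatr_eq0.
have ec : e @ \oo --> 0 by exact: cvg_harmonic.
exists (fun j => mxexp (- e j *: H) * mxexp (e j *: H')), e; split => //.
  move=> j; apply/range_symmetries_similarity.
  have := similarityM (EH (- e j)) (EH' (e j)).
  by rewrite !mulmxE mxexpN.
have -> : (fun j => (e j)^-1 *: (mxexp (- e j *: H) * mxexp (e j *: H') - 1%:M)) =
  (fun j => mxexp (- e j *: H) *m ((e j)^-1 *: (mxexp (e j *: H') - 1) -
                                  (e j)^-1 *: (mxexp (e j *: H) - 1))).
  apply/funext => j; rewrite -scalerBr -scalemxAr; congr (_ *: _).
  rewrite opprB addrA subrK mulmxE mulrBr mxexpN.
  by [].
have qH (M : mx) := cvg_mxexp_quotient e0 ec (@cvg_cst _ M _ \oo _).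
have e1 : (fun j => mxexp (- e j *: H)) @ \oo --> (1 : mx).
  rewrite -mxexp0 -(scale0r H) -oppr0; apply: cvg_mxexpZ.
  exact: cvgN ec.
rewrite -[H' - H]mul1mx.
apply: cvg_mulmx e1 _; apply: cvgB; exact: qH.
Qed.


Lemma cvg_from_quotient (g : nat -> mx) (e : nat -> R) A :
  (forall j, e j != 0) -> e @ \oo --> 0 ->
  (fun j => (e j)^-1 *: (g j - 1%:M)) @ \oo --> A -> g @ \oo --> (1 : mx).
Proof.
move=> e0 ec gA.
have -> : g = (fun j => e j *: ((e j)^-1 *: (g j - 1%:M)) + 1).
  by apply/funext => j; rewrite scalerA divff // scale1r subrK.
rewrite -[X in _ --> X]add0r -(scale0r A); apply: cvgD; last exact: cvg_cst.
exact: cvgZ.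
Qed.

(** Inverting [g j] changes the sign of its first-order term, so the steps may be
    taken positive. *)
Lemma tangent_positive A : tangent_space G A ->
  exists (g : nat -> mx) (e : nat -> R), [/\ forall j, G (g j),
    forall j, 0 < e j, e @ \oo --> 0 &
    (fun j => (e j)^-1 *: (g j - 1)) @ \oo --> A].
Proof.
move=> [g [e [Gg e0 ec gA]]].
have g1 := cvg_from_quotient e0 ec gA.
have [b [b1 Gb]] := range_sym_bounded.
pose g' j := if 0 < e j then g j else invmx (g j).
pose W j := if 0 < e j then 1 else invmx (g j).
exists g', (fun j => `|e j|); split.
- by move=> j; rewrite /g'; case: ifP => // _; exact: range_symV.
- by move=> j; rewrite normr_gt0.
- by rewrite -(normr0 R); exact: cvg_norm ec.
have W1 : W @ \oo --> (1 : mx).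
  apply: (@cvg_dist_bound _ _ _ _ (fun j => n.+1%:R * b * `|g j - 1|)).
    move=> j; rewrite /W; case: ifP => _; first by rewrite subrr normr0 !mulr_ge0 // (le_trans _ b1).
    have -> : invmx (g j) - 1 = invmx (g j) *m (1 - g j).
      by rewrite mulmxBr mulmx1 mulVmx ?range_sym_unit.
    rewrite (le_trans (norm_mulmx _ _)) // distrC ler_wpM2r // ler_wpM2l //.
    by apply: Gb; exact: range_symV.
  have d1 : (fun j => g j - 1) @ \oo --> (1 - 1 : mx).
    by apply: cvgB => //; exact: cvg_cst.
  have -> : (0 : R) = n.+1%:R * b * `|1 - 1 : mx| by rewrite subrr normr0 mulr0.
  by apply: cvgM; [exact: cvg_cst|exact: cvg_norm d1].
have -> : (fun j => `|e j|^-1 *: (g' j - 1)) =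
    (fun j => W j *m ((e j)^-1 *: (g j - 1%:M))).
  apply/funext => j; rewrite /W /g'; case: ltP => ej.
    by rewrite mul1mx gtr0_norm.
  rewrite ler0_norm // -scalemxAr invrN scaleNr -scalerN opprB mulmxBr mulmx1.
  by rewrite mulVmx ?range_sym_unit.
by rewrite -[A]mul1mx; exact: cvg_mulmx.
Qed.

(** The products [L j = exp (e j H) g j] scale [X] by [exp (e j E)] and are
    [1 + e j (H + A) + o (e j)]; raise them to the power [s / e j]. *)
Lemma exponents_add H A : EX H -> tangent_space G A -> EX (H + A).
Proof.
move=> /range_exponentP EH /tangent_positive[g [e [Gg e0 ec gA]]].
have ne0 j : e j != 0 by rewrite gt_eqF.
have g1 := cvg_from_quotient ne0 ec gA.
pose L j := mxexp (e j *: H) * g j.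
have simL j : similarity P X (mxexp (e j *: E)) (L j).
  have /range_symmetries_similarity gj := Gg j.
  by have := similarityM (EH (e j)) gj; rewrite mulmx1.
pose M j := (e j)^-1 *: (L j - 1).
have LM j : L j = 1 + e j *: M j.
  by rewrite scalerA divff // scale1r addrC subrK.
have cM : M @ \oo --> H + A.
  have -> : M = (fun j => (e j)^-1 *: (mxexp (e j *: H) - 1) *m g j +
                          (e j)^-1 *: (g j - 1)).
    apply/funext => j; rewrite /M /L -scalemxAl -scalerDr; congr (_ *: _).
    by rewrite mulmxBl mul1mx addrA subrK.
  apply: cvgD => //.
  suff : (fun j => (e j)^-1 *: (mxexp (e j *: H) - 1) *m g j) @ \oo --> H *m 1.
    by rewrite mulmx1.
  apply: cvg_mulmx g1.
  refine (@cvg_mxexp_quotient _ _ e (fun=> H) H ne0 ec _); exact: cvg_cst.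
have nonneg (s : R) : 0 <= s ->
    similarity P X (mxexp (s *: E)) (mxexp (s *: (H + A))).
  move=> s0; pose k j := Num.truncn (s / e j).
  have ck : (fun j => (k j)%:R * e j) @ \oo --> s.
    apply: (@cvg_dist_bound _ _ _ _ e) => // j.
    have /andP[lo hi] : (k j)%:R <= s / e j < (k j).+1%:R.
      by apply: truncn_itv; rewrite divr_ge0 // ltW.
    rewrite ler_pdivlMr // in lo; rewrite ltr_pdivrMr // -natr1 mulrDl mul1r in hi.
    by rewrite ler_norml; apply/andP; split; lra.
  have simk j : similarity P X (mxexp (((k j)%:R * e j) *: E)) (L j ^+ k j).
    by rewrite mxexp_mulrn; exact: similarityX.
  apply: (similarity_closed mX cX _ _ simk); first exact: cvg_mxexpZ.
  have -> : (fun j => L j ^+ k j) = (fun j => (1 + e j *: M j) ^+ k j).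
    by apply/funext => j; rewrite LM.
  exact: cvg_mx_euler.
apply/range_exponentP => s; have [s0|/ltW s0] := leP 0 s; first exact: nonneg.
have ns0 : 0 <= - s by rewrite oppr_ge0.
have := similarityV (mxexp_unit _ _) (mxexp_unit _ _) (nonneg _ ns0).
by rewrite !invmx_mxexp opprK.
Qed.

Lemma exponents_tangent H : EX H -> EX = [set H + A | A in tangent_space G].
Proof.
move=> EH; apply/seteqP; split=> [H' EH'|_ [A TA <-]]; last exact: exponents_add.
by exists (H' - H); [exact: exponents_sub|rewrite addrC subrK].
Qed.

Lemma tangent_half A : tangent_space G A -> tangent_space G (2^-1 *: A).
Proof.
move=> [g [e [Gg e0 ec gA]]]; exists g, (fun j => 2 * e j); split => //.
- by move=> j; rewrite mulf_neq0.
- by rewrite -(mulr0 2); apply: cvgM => //; exact: cvg_cst.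
have -> : (fun j => (2 * e j)^-1 *: (g j - 1%:M)) =
   (fun j => 2^-1 *: ((e j)^-1 *: (g j - 1%:M))).
  by apply/funext => j; rewrite scalerA invfM.
by apply: cvgZ => //; exact: cvg_cst.
Qed.

Lemma exponents_midpoint H H' : EX H -> EX H' -> EX (2^-1 *: (H + H')).
Proof.
move=> EH EH'.
have := exponents_add EH (tangent_half (exponents_sub EH EH')).
suff -> : 2^-1 *: (H + H') = H + 2^-1 *: (H' - H) by [].
by apply/matrixP => i j; rewrite !mxE; field.
Qed.

Lemma exponents_closed (u : nat -> mx) H : (forall j, EX (u j)) ->
  u @ \oo --> H -> EX H.
Proof.
move=> Eu uH; apply/range_exponentP => s.
have simu j : similarity P X (mxexp (s *: E)) (mxexp (s *: u j)).
  by have /range_exponentP := Eu j; apply.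
apply: (similarity_closed mX cX _ _ simu); first exact: cvg_cst.
by apply: cvg_mxexp; apply: cvgZ => //; exact: cvg_cst.
Qed.

Lemma exponents_conj B H : G B -> EX H -> EX (B * H * invmx B).
Proof.
move=> GB /range_exponentP EH; apply/range_exponentP => s.
have uB := range_sym_unit GB.
have /range_symmetries_similarity sB := GB.
have /range_symmetries_similarity sBV := range_symV GB.
have := similarityM (similarityM sB (EH s)) sBV.
rewrite mul1mx mulmx1 !mulmxE -mxexp_conj; last exact: mulVmx.
by rewrite scalerAl scalerAr.
Qed.

(** Conjugation by a symmetry preserves the closed convex set of exponents. *)
Lemma commuting_exponent : EX !=set0 ->
  exists2 H0, EX H0 & forall B, G B -> H0 * B = B * H0.
Proof.
move=> EX0; have [b [b1 Gb]] := range_sym_bounded.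
have b0 : 0 <= b by rewrite (le_trans _ b1).
pose GG : set (mx -> mx) := [set (fun M => B * M * invmx B) | B in G].
have [|||||||||H0 EH0 fix0] := @common_fixed_point R n.+1 GG (n.+1%:R * (n.+1%:R * b) * b) EX.
- move=> _ [B GB <-] a M N.
  by rewrite mulrDr mulrDl -scalerAr -scalerAl.
- exists 1; first exact: range_sym1.
  by apply/funext => M; rewrite mul1r invmx1 mulr1.
- move=> _ _ [B GB <-] [C GC <-]; exists (B * C); first exact: range_symM.
  apply/funext => M /=; rewrite -!mulmxE.
  have -> : invmx (B *m C) = invmx C *m invmx B.
    by have := @invrM _ B C (range_sym_unit GB) (range_sym_unit GC).
  by rewrite !mulmxA.
- move=> _ [B GB <-]; exists (fun M => invmx B * M * invmx (invmx B)).
    by exists (invmx B) => //; exact: range_symV.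
  move=> M; rewrite invmxK -!mulmxE !mulmxA mulVmx ?range_sym_unit // mul1mx.
  by rewrite -mulmxA mulVmx ?range_sym_unit // mulmx1.
- move=> _ [B GB <-] M; rewrite -!mulmxE (le_trans (norm_mulmx _ _)) //.
  have -> : n.+1%:R * (n.+1%:R * b) * b * `|M| = n.+1%:R * (n.+1%:R * b * `|M|) * b.
    by ring.
  apply: ler_pM => //.
  - rewrite ler_wpM2l // (le_trans (norm_mulmx _ _)) // ler_wpM2r //.
    by rewrite ler_wpM2l // Gb.
  - by apply: Gb; exact: range_symV.
- exact: EX0.
- exact: exponents_closed.
- exact: exponents_midpoint.
- by move=> _ M [B GB <-] KM; exact (exponents_conj GB KM).
exists H0 => // B GB.
have fixB : B * H0 * invmx B = H0 by apply: (fix0 (fun M => B * M * invmx B)); exists B.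
move: fixB.
move=> /(congr1 (fun M => M *m B)); rewrite -!mulmxE mulmxKV ?range_sym_unit //.
Qed.


(** The forms bounded below by [c] along every symmetry form an invariant closed
    convex set; it contains the identity because the inverses of the symmetries
    are bounded, which is where the value of [c] comes from. *)
Lemma invariant_form : exists Q, positive_form Q /\
  forall B, G B -> B *m Q *m B^T = Q.
Proof.
have [b [b1 Gb]] := range_sym_bounded.
have b0 : 0 <= b by rewrite (le_trans _ b1).
have nb0 : 0 < n.+1%:R * b by rewrite mulr_gt0 // (lt_le_trans _ b1).
pose c := (n.+1%:R * b) ^- 2.
have c0 : 0 < c by rewrite invr_gt0 exprn_gt0.
pose K : set mx := [set Q | Q^T = Q /\ forall B, G B -> forall x : 'rV[R]_n.+1,
  c * `|x| ^+ 2 <= ((x *m B) *m Q *m (x *m B)^T) 0 0].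
pose GG : set (mx -> mx) := [set (fun M => B *m M *m B^T) | B in G].
have [|||||||||Q [symQ QK] fixQ] := @common_fixed_point R n.+1 GG (n.+1%:R * (n.+1%:R * b) * b) K.
- move=> _ [B GB <-] a M N.
  by rewrite mulmxDr mulmxDl -scalemxAr -scalemxAl.
- exists 1; first exact: range_sym1.
  by apply/funext => M; rewrite mul1mx trmx1 mulmx1.
- move=> _ _ [B GB <-] [C GC <-]; exists (B * C); first exact: range_symM.
  by apply/funext => M /=; rewrite -!mulmxE trmx_mul !mulmxA.
- move=> _ [B GB <-]; exists (fun M => invmx B *m M *m (invmx B)^T).
    by exists (invmx B) => //; exact: range_symV.
  move=> M; rewrite !mulmxA mulVmx ?range_sym_unit // mul1mx.
  by rewrite -mulmxA -trmx_mul mulVmx ?range_sym_unit // trmx1 mulmx1.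
- move=> _ [B GB <-] M; rewrite (le_trans (norm_mulmx _ _)) //.
  have -> : n.+1%:R * (n.+1%:R * b) * b * `|M| = n.+1%:R * (n.+1%:R * b * `|M|) * b.
    by ring.
  apply: ler_pM => //.
  - rewrite ler_wpM2l // (le_trans (norm_mulmx _ _)) // ler_wpM2r //.
    by rewrite ler_wpM2l // Gb.
  - apply: mx_norm_le => // i j; rewrite mxE (le_trans (ler_entry_norm _ _ _)) //.
    exact: Gb.
- exists 1%:M; split=> [|B GB x]; first exact: trmx1.
  rewrite mulmx1 (le_trans _ (norm_row_le _)) //.
  rewrite /c mulrC ler_pdivrMr ?exprn_gt0 // -exprMn lerXn2r ?nnegrE //.
    by rewrite mulr_ge0 // ltW.
  rewrite -{1}[x](mulmxK (range_sym_unit GB)) (le_trans (norm_mulmx _ _)) //.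
  rewrite -mulrA [leRHS]mulrCA ler_wpM2l // mulrC [leRHS]mulrC ler_wpM2r //.
  by apply: Gb; exact: range_symV.
- move=> u M uK uM; split.
    apply: (cvg_mx_unique (u := u)) => //.
    have -> : u = (fun j => (u j)^T) by apply/funext => j; rewrite (uK j).1.
    exact: cvg_trmx.
  move=> B GB x.
  have lim : (fun j => (x *m B) *m u j *m (x *m B)^T) @ \oo -->
      (x *m B) *m M *m (x *m B)^T.
    apply: cvg_mulmx; last exact: cvg_cst.
    by apply: cvg_mulmx => //; exact: cvg_cst.
  have lim0 : (fun j => ((x *m B) *m u j *m (x *m B)^T) 0 0) @ \oo -->
      ((x *m B) *m M *m (x *m B)^T) 0 0 by move: lim => /cvg_mxP; apply.
  apply: (cvgr_to_ge lim0); apply: nearW => j; exact: (uK j).2.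
- move=> M N [trM KM] [trN KN]; split.
    by rewrite linearZ linearD /= trM trN.
  move=> B GB x; rewrite -scalemxAr -scalemxAl mulmxDr mulmxDl 2!mxE.
  by have := KM B GB x; have := KN B GB x; lra.
- move=> _ M [B GB <-] [sM KM]; split.
    by rewrite !trmx_mul trmxK sM mulmxA.
  move=> C GC x; have := KM _ (range_symM GC GB) x.
  by rewrite -!mulmxE !trmx_mul !mulmxA.
exists Q; split; last by move=> B GB; apply: (fixQ (fun M => B *m M *m B^T)); exists B.
split => // x x0; have := QK 1 range_sym1 x; rewrite mulmx1; apply: lt_le_trans.
by rewrite mulr_gt0 // exprn_gt0 // normr_gt0.
Qed.

(** Expand [0 = (g j *m Q *m (g j)^T - Q) / e j] to first order in [g j - 1]. *)
Lemma tangent_skew Q A : (forall B, G B -> B *m Q *m B^T = Q) ->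
  tangent_space G A -> skew_for Q A.
Proof.
move=> GQ [g [e [Gg e0 ec gA]]].
have g1 := cvg_from_quotient e0 ec gA.
apply/eqP; rewrite -addr_eq0; apply/eqP.
have lim : (fun j => ((e j)^-1 *: (g j - 1%:M)) *m Q *m (g j)^T +
    Q *m ((e j)^-1 *: (g j - 1%:M))^T) @ \oo --> A *m Q *m 1^T + Q *m A^T.
  apply: cvgD.
    apply: cvg_mulmx; last exact: cvg_trmx.
    by apply: cvg_mulmx => //; exact: cvg_cst.
  by apply: cvg_mulmx; [exact: cvg_cst|exact: cvg_trmx].
rewrite trmx1 mulmx1 in lim.
apply: (cvg_mx_unique lim).
have -> : (fun j => ((e j)^-1 *: (g j - 1%:M)) *m Q *m (g j)^T +
    Q *m ((e j)^-1 *: (g j - 1%:M))^T) = fun=> 0.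
  apply/funext => j; rewrite linearZ /= -!scalemxAl -scalemxAr -scalerDr.
  rewrite linearB /= trmx1 mulmxBl mulmxBl GQ // mul1mx mulmxBr mulmx1.
  by rewrite addrA subrK subrr scaler0.
exact: cvg_cst.
Qed.

Lemma tangent_comm H A : (forall B, G B -> H * B = B * H) ->
  tangent_space G A -> H * A = A * H.
Proof.
move=> HG [g [e [Gg e0 ec gA]]].
have l1 : (fun j => H *m ((e j)^-1 *: (g j - 1%:M))) @ \oo --> H *m A.
  by apply: cvg_mulmx => //; exact: cvg_cst.
have l2 : (fun j => ((e j)^-1 *: (g j - 1%:M)) *m H) @ \oo --> A *m H.
  by apply: cvg_mulmx => //; exact: cvg_cst.
apply: (cvg_mx_unique l1).
suff -> : (fun j => H *m ((e j)^-1 *: (g j - 1%:M))) =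
  (fun j => ((e j)^-1 *: (g j - 1%:M)) *m H) by [].
apply/funext => j; rewrite -scalemxAr -scalemxAl; congr (_ *: _).
rewrite mulmxBr mulmxBl mulmx1 mul1mx; congr (_ - _); exact: HG.
Qed.

(** Everything follows from [H = H0 + A] with [A] skew for an invariant form and
    commuting with [H0]. *)
Lemma exponents_structure : EX !=set0 ->
  [/\ forall H, EX H -> EX = [set H + A | A in tangent_space G],
      exists H0, EX H0 /\ forall A, G A -> H0 *m A = A *m H0,
      exists N, (forall H, EX H -> forall N', is_nilpotent_part H N' <-> N' = N) /\
        (forall A, G A -> N *m A = A *m N)
    & forall H H', EX H -> EX H' -> real_spectrum H = real_spectrum H'].
Proof.
move=> EX0; have [H0 EH0 comH0] := commuting_exponent EX0.
have [Q [pQ GQ]] := invariant_form.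
have skew H : EX H -> skew_for Q (H - H0).
  by move=> EH; apply: (tangent_skew GQ); exact: exponents_sub.
have com H : EX H -> H0 * (H - H0) = (H - H0) * H0.
  by move=> EH; apply: (tangent_comm comH0); exact: exponents_sub.
split.
- exact: exponents_tangent.
- by exists H0.
- have [s [dS [i Ni]]] := jordan_decomposition H0.
  set S0 := horner_mx H0 s in dS Ni; pose N := H0 - S0.
  exists N; split=> [H EH N'|B GB]; last first.
    rewrite mulmxBl mulmxBr; congr (_ - _); first exact: comH0.
    by apply: comm_horner_mx; exact: comH0.
  have S0A : S0 * (H - H0) = (H - H0) * S0 by apply: comm_horner_mx; exact: com.
  have partN : is_nilpotent_part H N.
    exists (S0 + (H - H0)); split.
    - by rewrite /N addrC addrA subrK addrC subrK.
    - rewrite complex_mxD; apply: (diagonalizable_comm dS _ _).1.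
        exact: skew_diagonalizable pQ (skew H EH).
      by rewrite -!complex_mxM S0A.
    - by exists i.
    - have S0N : S0 *m N = N *m S0.
        by rewrite /N mulmxBr mulmxBl; congr (_ - _); exact: comm_horner_mx.
      have AN : (H - H0) *m N = N *m (H - H0).
        rewrite /N mulmxBr [RHS]mulmxBl; congr (_ - _); last exact/esym.
        exact/esym/com.
      by rewrite (mulmxDl S0) (mulmxDr N) S0N AN.
  have [t [dt nt]] := jordan_decomposition H.
  have uniq := nilpotent_part_unique dt nt.
  by rewrite ((uniq N).1 partN); exact: uniq.
have specH0 H : EX H -> real_spectrum H = real_spectrum H0.
  move=> EH; have sH := skew H EH; have cH := com H EH.
  apply/seteqP; split.
    by have := real_spectrum_add_skew pQ sH cH; rewrite addrC subrK.
  have sN : skew_for Q (- (H - H0)) by exact: skew_forN.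
  have opp_comm (D : mx) : H0 * D = D * H0 -> (H0 + D) *m - D = - D *m (H0 + D).
    by move=> c; rewrite mulmxN mulNmx mulmxDl mulmxDr !mulmxE c.
  have cN := opp_comm _ cH; rewrite [H0 + _]addrC subrK in cN.
  by have := real_spectrum_add_skew pQ sN cN; rewrite opprB addrC subrK.
by move=> H H' EH EH'; rewrite !specH0.
Qed.

End RangeExponents.

Theorem theorem2p4 (d : measure_display) (T : measurableType d) (R : realType)
    (P : probability T R) (m n : nat) (m_gt0 : (0 < m)%N)
    (X : 'cV[R]_m -> T -> 'cV[R]_n) (E : 'M[R]_m)
    (X_oss : domain_exponent P X E) :
  [/\ forall H, range_exponents P X E H ->
        range_exponents P X E =
        [set H + A | A in tangent_space (range_symmetries P X)],
      exists H0, range_exponents P X E H0 /\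
        forall A, range_symmetries P X A -> H0 *m A = A *m H0,
      exists N : 'M[R]_n,
        (forall H, range_exponents P X E H ->
           forall N', is_nilpotent_part H N' <-> N' = N) /\
        (forall A, range_symmetries P X A -> N *m A = A *m N)
    & forall H H', range_exponents P X E H -> range_exponents P X E H' ->
        real_spectrum H = real_spectrum H'].
Proof.
case: X_oss => H0 [[mX pX ndX cX] [_ _ sH0]].
case: m m_gt0 X E mX pX ndX cX sH0 => [//|m'] _ X' E' mX pX ndX cX sH0.
(* Without coordinates, every projection of the index is harmless, so [X] would be
   degenerate. *)
case: n X' H0 mX pX ndX cX sH0 => [|n'] X' H0 mX pX ndX cX sH0.
  case: ndX; exists 0; split; first by rewrite mulmx0.
    by rewrite eq_sym; exact: (oner_neq0 'M[R]_m'.+1).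
  by move=> t; apply: aeW => w; apply/matrixP => -[].
by apply: exponents_structure; [exact: mX|exact: pX|exact: cX|exists H0].
Qed.
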